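(* Let $n\ge 2$ and let $C\subseteq\mathbb R^n$ be a cone. Then $\left(S^{n-1},C\right)$ is a Heisenberg uniqueness pair if and only if, for every $l\in\mathbb Z_+$ and every nonzero $P\in H_l$, the set $C$ is not contained in $P^{-1}(0)=\{x\in\mathbb R^n: P(x)=0\}$.
   Context: A set $C\subseteq\mathbb R^n$ ($n\ge2$) is called a cone if $\lambda C\subseteq C$ for all $\lambda\in\mathbb R$. $S^{n-1}$ is the unit sphere in $\mathbb R^n$, and $\mathbb Z_+$ is the set of non-negative integers. $H_l$ is the space of homogeneous polynomials $P$ of degree $l$ in $n$ variables with $\Delta P=0$, where $\Delta$ is the standard Laplacian on $\mathbb R^n$. For a finite complex Borel measure $\mu$ on $\mathbb R^n$ supported on $S^{n-1}$, the Fourier transform is $\hat\mu(\xi)=\int_{S^{n-1}}e^{-i\xi\cdot\eta}\,d\mu(\eta)$, $\xi\in\mathbb R^n$. For $\Lambda\subseteq\mathbb R^n$, the pair $(S^{n-1},\Lambda)$ is a Heisenberg uniqueness pair if every finite complex Borel measure $\mu$ on $\mathbb R^n$ that is supported on $S^{n-1}$, is absolutely continuous with respect to the surface measure on $S^{n-1}$, and satisfies $\hat\mu|_\Lambda=0$ must be $\mu=0$. *)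

(* Defs.v *)
From HB Require Import structures.
From mathcomp Require Import all_boot all_order all_algebra.
From mathcomp Require Import all_classical all_reals all_analysis.
From mathcomp Require Import measurable_realfun complex.
From mathcomp Require mpoly.
(* The notations of mpoly clash with those of mathcomp-analysis. *)
Export (canonicals, coercions) mpoly.

Set Implicit Arguments.
Unset Strict Implicit.
Unset Printing Implicit Defensive.

Import Order.TTheory GRing.Theory Num.Theory.
Import numFieldNormedType.Exports.

Local Open Scope classical_set_scope.
Local Open Scope ring_scope.
Local Open Scope complex_scope.

(* [R^n] is [n.-tuple R]: its canonical sigma-algebra, generated by the
   coordinate maps into the Borel space [R], is the Borel sigma-algebra. *)

Section euclidean_space.
Context (R : realType) (n : nat).
Implicit Types x y : n.-tuple R.

Definition scalev (a : R) x : n.-tuple R := [tuple a * tnth x i | i < n].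

Definition dotv x y : R := \sum_(i < n) tnth x i * tnth y i.

Definition normv x : R := Num.sqrt (dotv x x).

Definition unit_sphere : set (n.-tuple R) := [set x | normv x = 1].

Definition is_cone (C : set (n.-tuple R)) : Prop :=
  forall a : R, scalev a @` C `<=` C.

Lemma measurable_normv : measurable_fun setT normv.
Proof.
apply: (@measurableT_comp _ _ _ _ _ _ (@Num.sqrt R)).
  by apply: continuous_measurable_fun; exact: sqrt_continuous.
apply: (@measurable_sum _ _ R setT 'I_n (index_enum _)
  (fun i x => tnth x i * tnth x i)) => i.
by apply: measurable_funM; exact: measurable_tnth.
Qed.

Definition radial_proj x : n.-tuple R := scalev (normv x)^-1 x.

Lemma measurable_radial_proj : measurable_fun setT radial_proj.
Proof.
apply/measurable_fun_tnthP => i.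
rewrite (_ : _ \o _ = (fun x => (normv x)^-1 * tnth x i)); last first.
  by apply/funext => x /=; rewrite tnth_mktuple.
apply: measurable_funM; last exact: measurable_tnth.
apply: (@measurableT_comp _ _ _ _ _ _ (@GRing.inv R)); last first.
  exact: measurable_normv.
rewrite -(setvU [set 0 : R]); apply/measurable_funU => //.
  exact: measurableC.
split; last exact: measurable_fun_set1.
apply: open_continuous_measurable_fun.
  by rewrite openC; exact: closed_eq.
by move=> x /set_mem/eqP x0; exact: inv_continuous.
Qed.

Definition punctured_ball : set (n.-tuple R) := [set x | 0 < normv x <= 1].

Lemma measurable_punctured_ball : measurable punctured_ball.
Proof.
rewrite (_ : punctured_ball = normv @^-1` `]0, 1]%classic); last first.
  by apply/seteqP; split => x /=; rewrite in_itv.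
by rewrite -[X in measurable X]setTI; exact: measurable_normv.
Qed.

End euclidean_space.

Section lebesgue_succ.
Context (R : realType) (n : nat).
Variable m : {sigma_finite_measure set (n.-tuple R) -> \bar R}.

Definition consv (p : measurableTypeR R * n.-tuple R) : n.+1.-tuple R :=
  [the n.+1.-tuple R of (p.1 : R) :: p.2].

Lemma measurable_consv : measurable_fun setT consv.
Proof.
apply: (@measurable_cons _ _ _ R (fun p : measurableTypeR R * n.-tuple R => p.1)
  n snd); last exact: measurable_snd.
exact: (@measurable_fst _ _ (measurableTypeR R) (n.-tuple R)).
Qed.

Definition lebesgue_succ : set (n.+1.-tuple R) -> \bar R :=
  pushforward (lebesgue_measure \x m)%E consv.

Let prod_measure :
    {measure set (measurableTypeR R * n.-tuple R)%type -> \bar R} :=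
  (lebesgue_measure \x m)%E.

Let lebesgue_succ0 : lebesgue_succ set0 = 0%E.
Proof. by rewrite /lebesgue_succ /pushforward preimage_set0 measure0. Qed.

Let lebesgue_succ_ge0 A : (0 <= lebesgue_succ A)%E.
Proof. exact: (measure_ge0 prod_measure). Qed.

Let lebesgue_succ_sigma_additive : semi_sigma_additive lebesgue_succ.
Proof.
move=> F mF tF mUF; rewrite /lebesgue_succ /pushforward preimage_bigcup.
have mpre A : measurable A -> measurable (consv @^-1` A).
  by move=> mA; rewrite -[X in measurable X]setTI; exact: measurable_consv.
apply: (@measure_semi_sigma_additive _ _ _ prod_measure).
- by move=> k; exact: mpre.
- apply/trivIsetP => i j _ _ ij; rewrite -preimage_setI.
  by move/trivIsetP : tF => /(_ _ _ Logic.I Logic.I ij) ->; rewrite preimage_set0.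
- by rewrite -preimage_bigcup; exact: mpre.
Qed.

HB.instance Definition _ := isMeasure.Build _ _ _ lebesgue_succ
  lebesgue_succ0 lebesgue_succ_ge0 lebesgue_succ_sigma_additive.

Let lebesgue_succ_sigma_finite : sigma_finite setT lebesgue_succ.
Proof.
have /sigma_finiteP[F [TF ndF Foo]] := sigma_finiteT (@lebesgue_measure R).
have /sigma_finiteP[G [TG ndG Goo]] := sigma_finiteT m.
exists (fun k => [set x : n.+1.-tuple R | F k (thead x) /\
                                          G k [tuple of behead x]]).
  apply/esym; rewrite -subTset => x _.
  have [i _ Fi] : (\bigcup_i F i) (thead x) by rewrite -TF.
  have [j _ Gj] : (\bigcup_i G i) [tuple of behead x] by rewrite -TG.
  exists (maxn i j) => //; split.
    by move: Fi; exact/subsetPset/ndF/leq_maxl.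
  by move: Gj; exact/subsetPset/ndG/leq_maxr.
move=> k; have [mF Fk] := Foo k; have [mG Gk] := Goo k; split.
  apply: measurableI.
    by rewrite -[X in measurable X]setTI; exact: (measurable_tnth ord0).
  by rewrite -[X in measurable X]setTI; exact: measurable_behead.
rewrite /lebesgue_succ /pushforward (_ : _ @^-1` _ = F k `*` G k).
  by rewrite product_measure1E// lte_mul_pinfty// ge0_fin_numE.
have consvK p : [tuple of behead (consv p)] = p.2 by exact: val_inj.
by apply/seteqP; split=> p /=; rewrite theadE consvK.
Qed.

HB.instance Definition _ := Measure_isSigmaFinite.Build _ _ _ lebesgue_succ
  lebesgue_succ_sigma_finite.

End lebesgue_succ.

Fixpoint lebesgue_tuple (R : realType) (n : nat) :
    {sigma_finite_measure set (n.-tuple R) -> \bar R} :=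
  if n is n'.+1 then lebesgue_succ (lebesgue_tuple R n') else \d_([tuple] : 0.-tuple R).

Section surface_measure.
Context (R : realType) (n : nat).

(* The measure of [A] is [n] times the volume of the part of the unit ball
   that projects radially into [A]; it is carried by the unit sphere. *)
Definition surface_measure (A : set (n.-tuple R)) : \bar R :=
  (n%:R%:E * lebesgue_tuple R n (@radial_proj R n @^-1` A `&` @punctured_ball R n))%E.

Let lebesgue_ball : {measure set (n.-tuple R) -> \bar R} :=
  mrestr (lebesgue_tuple R n) (@measurable_punctured_ball R n).

Let surface_measure0 : surface_measure set0 = 0%E.
Proof. by rewrite /surface_measure preimage_set0 set0I measure0 mule0. Qed.

Let surface_measure_ge0 A : (0 <= surface_measure A)%E.
Proof. by rewrite mule_ge0. Qed.

Let surface_measure_sigma_additive : semi_sigma_additive surface_measure.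
Proof.
have mpre A : measurable A -> measurable (@radial_proj R n @^-1` A).
  by move=> mA; rewrite -[X in measurable X]setTI; exact: measurable_radial_proj.
move=> F mF tF mUF; rewrite /surface_measure preimage_bigcup.
rewrite (_ : (fun _ => _) = (fun k => n%:R%:E *
    \sum_(0 <= i < k) lebesgue_ball (@radial_proj R n @^-1` F i))%E); last first.
  by apply/funext => k; rewrite ge0_sume_distrr.
apply: cvgeZl => //; apply: (@measure_semi_sigma_additive _ _ _ lebesgue_ball).
- by move=> k; exact: mpre.
- apply/trivIsetP => i j _ _ ij; rewrite -preimage_setI.
  by move/trivIsetP : tF => /(_ _ _ Logic.I Logic.I ij) ->; rewrite preimage_set0.
- by rewrite -preimage_bigcup; exact: mpre.
Qed.

HB.instance Definition _ := isMeasure.Build _ _ _ surface_measure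
  surface_measure0 surface_measure_ge0 surface_measure_sigma_additive.

End surface_measure.

Section complex_measure.
Context d (T : measurableType d) (R : realType).

(* Charges are finite by definition. *)
Record complex_measure := ComplexMeasure {
  re_measure : {charge set T -> \bar R} ;
  im_measure : {charge set T -> \bar R} }.

Definition complex_measure_fun (mu : complex_measure) (A : set T) : R[i] :=
  fine (re_measure mu A) +i* fine (im_measure mu A).

Coercion complex_measure_fun : complex_measure >-> Funclass.

(* The difference of the integrals against the Jordan parts of [nu]; these do
   not depend on the chosen Hahn decomposition. *)
Definition charge_integral (nu : {charge set T -> \bar R}) (D : set T)
    (f : T -> R) : R :=
  let P := cid (Hahn_decomposition nu) in
  let N := cid (svalP P) in
  \int[jordan_pos (svalP N)]_(x in D) f x - \int[jordan_neg (svalP N)]_(x in D) f x.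

Definition complex_integral (mu : complex_measure) (D : set T)
    (f : T -> R[i]) : R[i] :=
  (charge_integral (re_measure mu) D (fun x => complex.Re (f x)) -
   charge_integral (im_measure mu) D (fun x => complex.Im (f x))) +i*
  (charge_integral (re_measure mu) D (fun x => complex.Im (f x)) +
   charge_integral (im_measure mu) D (fun x => complex.Re (f x))).

Definition supported_on (mu : complex_measure) (S : set T) : Prop :=
  forall A, measurable A -> A `&` S = set0 -> mu A = 0.

Definition absolutely_continuous (mu : complex_measure)
    (sigma : {measure set T -> \bar R}) : Prop :=
  forall A, measurable A -> sigma A = 0%E -> mu A = 0.

End complex_measure.

Section heisenberg_uniqueness.
Context (R : realType) (n : nat).

Definition expi (t : R) : R[i] := cos t +i* sin t.

Definition fourier (mu : complex_measure (n.-tuple R) R) (xi : n.-tuple R) :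
    R[i] :=
  complex_integral mu (@unit_sphere R n) (fun eta => expi (- dotv xi eta)).

Definition sphere_heisenberg_pair (L : set (n.-tuple R)) : Prop :=
  forall mu : complex_measure (n.-tuple R) R,
    supported_on mu (@unit_sphere R n) ->
    absolutely_continuous mu (@surface_measure R n) ->
    (forall xi, L xi -> fourier mu xi = 0) ->
    forall A, measurable A -> mu A = 0.

End heisenberg_uniqueness.

Section harmonic_polynomials.
Context (R : realType) (n : nat).
Implicit Types P : mpoly.mpoly n R[i].

Definition laplacian P : mpoly.mpoly n R[i] :=
  \sum_(i < n) mpoly.mderiv i (mpoly.mderiv i P).

Definition harmonic_homog (l : nat) : set (mpoly.mpoly n R[i]) :=
  [set P | P \is mpoly.ishomog1 l mpoly.mdeg /\ laplacian P = 0].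

Definition real_zeros P : set (n.-tuple R) :=
  [set x | mpoly.meval (fun i => (tnth x i)%:C) P = 0].

End harmonic_polynomials.

(* Main.v *)
From HB Require Import structures.
Require Import Defs.
From mathcomp Require Import all_boot all_order all_algebra.
From mathcomp Require Import all_classical all_reals all_analysis.
From mathcomp Require Import measurable_realfun complex.
From mathcomp Require Import ring lra.
From mathcomp Require mpoly ssrcomplements.

Set Implicit Arguments.
Unset Strict Implicit.
Unset Printing Implicit Defensive.

Import Order.TTheory GRing.Theory Num.Theory.
Import numFieldNormedType.Exports.

Local Open Scope classical_set_scope.
Local Open Scope ring_scope.

(** Write hat mu for [fourier mu], xi . eta for [dotv xi eta], and sigma for
    the surface measure. Both implications go through the moments
    m_k(xi) = int (xi . eta)^k dmu(eta). If hat mu vanishes on the line spanned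
    by xi, then all m_k(xi) vanish, as one sees by differentiating
    t |-> hat mu(t xi) at 0 ([charge_integral_moments]); conversely, if all
    m_k(xi) vanish then so does hat mu(xi), by expanding the exponential
    ([charge_integral_cos_sin]). A complex measure is a pair of real charges,
    and the real and the imaginary part can be treated separately.

    Suppose that no nonzero harmonic homogeneous polynomial vanishes on the cone
    C, and that hat mu vanishes on C. Then Q_k = m_k / k! is a homogeneous
    polynomial of degree k that vanishes on C. Since |eta| = 1 on the sphere,
    the Laplacian of Q_k is Q_(k-2), so the first nonzero Q_k would be harmonic
    ([divpow_first_harmonic]), against the hypothesis. So all Q_k are zero,
    which means that all moments of mu are zero, and a charge on the sphere is
    determined by its moments ([charge_moments_eq0]): indicators of boxes are
    bounded pointwise limits of explicit polynomials.

    Suppose that P is harmonic, homogeneous, nonzero, and vanishes on C. Then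
    mu = P sigma is a counterexample to uniqueness. The classical argument is
    the Funk-Hecke formula, by which int (xi . eta)^k P(eta) dsigma(eta) is a
    multiple of P(xi). Here the integrals are transported from the sphere to the
    whole space: on homogeneous polynomials of a given degree, the spherical
    integral is a positive multiple of the Gaussian mean
    E Q = int Q(x) exp(-|x|^2) dx ([sphere_integral_real_eval]). The Gaussian
    mean is governed by one algebraic rule, integration by parts
    E (X_i Q) = E (d_i Q) / 2 ([gaussian_ibp]). It yields
    E ((xi . x)^k P) = 0 whenever P(xi) = 0 ([gaussian_linformX]), hence
    hat mu = 0 on C. It also yields E (x^a P) <> 0 for every monomial x^a of P
    of nonzero coefficient ([gaussian_coef]), hence mu <> 0. The passage from
    the sphere to the space uses only that Lebesgue measure is scaled by r^n
    under the dilation of ratio r, as sigma is the volume of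
    cones over sets on the sphere ([lebesgue_cone_shell]). *)

(** * Harmonic polynomials under a Gaussian functional *)

Module HarmonicAlgebra.
Import -(notations) mpoly.

Section harmonic_algebra.
Context (K : numFieldType) (n : nat).
Implicit Types (p q : mpoly n K) (m : multinom n) (i j : 'I_n) (x : 'I_n -> K).

Local Notation "p ^`M ( i )" := (mderiv i p)
  (at level 8, format "p ^`M ( i )").
Local Notation "p @_ m" := (mcoeff m p) (at level 3, m at level 2).
Local Notation homog l p := (p \is ishomog1 l mdeg).

Definition lap p := \sum_(i < n) p^`M(i)^`M(i).

Definition dderiv x p := \sum_(i < n) x i *: p^`M(i).

Definition linform x : mpoly n K := \sum_(i < n) x i *: mpolyX K (mnm1 i).

Lemma homogP l p : reflect (forall m, mdeg m != l -> p@_m = 0) (homog l p).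
Proof.
apply: (iffP idP) => [ph m|ph]; first exact: dhomog_nemf_coeff.
apply/dhomogP => m; rewrite mcoeff_msupp => pm.
by apply/eqP; apply: contraNT pm => /ph ->.
Qed.

Lemma homog_mderiv l p i : homog l p -> homog l.-1 p^`M(i).
Proof.
move=> /homogP ph; apply/homogP => m ml; rewrite mcoeff_mderiv ph ?mul0rn//.
by apply: contraNneq ml => <-; rewrite mdegD mdeg1 addn1.
Qed.

Lemma homog0_deriv p i : homog 0 p -> p^`M(i) = 0.
Proof.
move=> /homogP ph; apply/mpolyP => m; rewrite mcoeff_mderiv mcoeff0 ph ?mul0rn//.
by rewrite mdegD mdeg1 addn1.
Qed.

Lemma lap_mderiv p i : lap p^`M(i) = (lap p)^`M(i).
Proof.
rewrite /lap linear_sum; apply: eq_bigr => j _ /=.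
by rewrite (mderiv_comm i j) (mderiv_comm i j).
Qed.

Lemma lap_dderiv x p : lap p = 0 -> lap (dderiv x p) = 0.
Proof.
move=> p0; have -> : lap (dderiv x p) = dderiv x (lap p).
  rewrite /dderiv; under [RHS]eq_bigr do rewrite -lap_mderiv /lap scaler_sumr.
  rewrite exchange_big; apply: eq_bigr => i _ /=.
  rewrite [X in mderiv i X](_ : _ = \sum_(j < n) x j *: (p^`M(j))^`M(i)).
    rewrite (linear_sum (mderiv i)).
    by apply: eq_bigr => j _; rewrite /= mderivZ.
  rewrite (linear_sum (mderiv i)).
  by apply: eq_bigr => j _; rewrite /= mderivZ.
by rewrite p0 /dderiv big1// => i _; rewrite linear0 scaler0.
Qed.

Lemma homog_dderiv l x p : homog l p -> homog l.-1 (dderiv x p).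
Proof.
by move=> ph; apply: rpred_sum => i _; apply: rpredZ; exact: homog_mderiv.
Qed.

Lemma euler l p : homog l p ->
  \sum_(i < n) mpolyX K (mnm1 i) * p^`M(i) = l%:R *: p.
Proof.
move=> /dhomogP ph.
under eq_bigr do rewrite /mderiv mulr_sumr.
rewrite exchange_big/= [in RHS](mpolyE p) scaler_sumr.
rewrite [LHS]big_seq [RHS]big_seq; apply: eq_bigr => m mp.
transitivity (\sum_(i < n) ((m i)%:R * p@_m) *: mpolyX K m); last first.
  rewrite -scaler_suml -mulr_suml -natr_sum scalerA -mdegE.
  by rewrite -[in RHS](ph _ mp).
apply: eq_bigr => i _; rewrite -scalerAr (mulrC (mpolyX _ _)) -mpolyXD.
have [->|mi0] := eqVneq (m i) 0%N; first by rewrite mul0r !scale0r.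
rewrite submK//; apply/mnm_lepP => j; rewrite mnm1E.
by case: eqP => // <-; rewrite lt0n.
Qed.

Lemma mderiv_linformX x k i :
  (linform x ^+ k)^`M(i) = (x i * k%:R) *: linform x ^+ k.-1.
Proof.
elim: k => [|k IH]; first by rewrite expr0 -mpolyC1 mderivC mulr0 scale0r.
rewrite exprS mderivM IH /= (_ : (linform x)^`M(i) = mpolyC n (x i)); last first.
  rewrite /linform (linear_sum (mderiv i)) (bigD1 i)//= mderivZ mderivX.
  rewrite mnm1E eqxx scale1r -[X in mnm_sub X _]add0m addmK mpolyX0 alg_mpolyC.
  rewrite big1 ?addr0// => j ji; rewrite mderivZ mderivX mnm1E (negbTE ji).
  by rewrite scale0r scaler0.
case: k {IH} => [|k].
  by rewrite expr0 mulr0 scale0r mulr0 addr0 !mulr1 alg_mpolyC.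
rewrite -scalerAr -exprS mul_mpolyC -scalerDl.
by congr (_ *: _); rewrite -[k.+2%:R]natr1; ring.
Qed.

Lemma euler_meval l x p : homog l p -> meval x (dderiv x p) = l%:R * meval x p.
Proof.
move=> /euler /(congr1 (meval x)); rewrite mevalZ => <-.
rewrite !raddf_sum/=; apply: eq_bigr => i _.
by rewrite mevalZ mevalM mevalXU.
Qed.

(** The linear extension of prescribed values on monomials; it makes integrals
    of polynomials accessible to algebra once the moments are known. *)
Definition moment (w : multinom n -> K) p := \sum_(m <- msupp p) p@_m * w m.

Lemma moment_wide w p k : (mmeasure mdeg p <= k)%N ->
  moment w p = \sum_(m : bmultinom n k) p@_m * w m.
Proof.
move=> pk; rewrite /moment (ssrcomplements.big_mksub (bmultinom n k)) /=; first last.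
- by move=> m /msize_mdeg_lt /leq_trans; apply.
- exact: msupp_uniq.
by rewrite big_rmcond //= => m /memN_msupp_eq0 ->; rewrite mul0r.
Qed.

Lemma moment_is_linear w : scalar (moment w).
Proof.
move=> c p q.
pose k := maxn (mmeasure mdeg (c *: p + q)) (maxn (mmeasure mdeg p) (mmeasure mdeg q)).
rewrite !(@moment_wide _ _ k) ?leq_max ?leqnn ?orbT//.
rewrite mulr_sumr -big_split; apply: eq_bigr => m _ /=.
by rewrite mcoeffD mcoeffZ mulrDl mulrA.
Qed.

HB.instance Definition _ w :=
  GRing.isLinear.Build K (mpoly n K) K _ (moment w) (moment_is_linear w).

Lemma momentX w m : moment w (mpolyX K m) = w m.
Proof. by rewrite /moment msuppX big_seq1 mcoeffX eqxx mul1r. Qed.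

Section gaussian_moments.
Variable (g : nat -> K).
(* The recursion satisfied by the moments of exp(-x^2) on the line. *)
Hypothesis g1 : g 1 = 0.
Hypothesis gS : forall k, g k.+2 = k.+1%:R / 2 * g k.

Let E := moment (fun m => \prod_(i < n) g (m i)).

Let E_sum I (r : seq I) (P : pred I) (F : I -> mpoly n K) :
  E (\sum_(i <- r | P i) F i) = \sum_(i <- r | P i) E (F i).
Proof. exact: (linear_sum (moment _)). Qed.

Let ED p q : E (p + q) = E p + E q.
Proof. exact: (linearD (moment _)). Qed.

Let EZ c p : E (c *: p) = c * E p.
Proof. by rewrite /E linearZ. Qed.

Let E0 : E 0 = 0. Proof. exact: (linear0 (moment _)). Qed.

Let EX m : E (mpolyX K m) = \prod_(i < n) g (m i).
Proof. exact: momentX. Qed.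

(** Integration by parts against exp(-|x|^2); on monomials it is the recursion
    for [g] in the [i]-th exponent. *)
Lemma gaussian_ibp i p : E (mpolyX K (mnm1 i) * p) = 2^-1 * E p^`M(i).
Proof.
rewrite [p in LHS]mpolyE mulr_sumr /mderiv.
rewrite !E_sum mulr_sumr.
apply: eq_bigr => m _ /=.
rewrite -scalerAr -mpolyXD !EZ !EX.
rewrite (mulrC (m i)%:R) -(mulrA p@_m) [RHS]mulrCA; congr (_ * _).
rewrite (bigD1 i)//= [in RHS](bigD1 i)//=.
rewrite !mulrA; congr (_ * _); last first.
  apply: eq_bigr => j ji; rewrite mnmDE mnmBE mnm1E.
  by rewrite (negbTE (_ : i != j)) 1?eq_sym// subn0.
rewrite mnmDE mnmBE mnm1E eqxx/= add1n subn1.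
by case: (m i) => [|k]; rewrite /= ?g1 ?gS; ring.
Qed.

Local Notation harmonic l p := (homog l p /\ lap p = 0).

Lemma harmonic_dderiv l x p : harmonic l p -> harmonic l.-1 (dderiv x p).
Proof. by move=> [ph p0]; split; [exact: homog_dderiv|exact: lap_dderiv]. Qed.

Lemma harmonic_mderiv l i p : harmonic l p -> harmonic l.-1 p^`M(i).
Proof.
by move=> [ph p0]; split; [exact: homog_mderiv|rewrite lap_mderiv p0 linear0].
Qed.

(** Euler's identity writes [p] in terms of the products of [X_i] with the
    [i]-th derivative, and integration by parts turns their sum into the
    Laplacian. *)
Lemma gaussian_mean0 l p : (0 < l)%N -> harmonic l p -> E p = 0.
Proof.
move=> l0 [ph p0]; have : E (l%:R *: p) = 0.
  rewrite -(euler ph) E_sum.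
  under eq_bigr do rewrite gaussian_ibp.
  by rewrite -mulr_sumr -E_sum -/(lap p) p0 E0 mulr0.
rewrite EZ => /eqP; rewrite mulf_eq0 pnatr_eq0 eqn0Ngt l0/=.
by move/eqP.
Qed.

Lemma gaussian_linformM x p :
  E (linform x * p) = 2^-1 * E (dderiv x p).
Proof.
rewrite mulr_suml /dderiv !E_sum mulr_sumr; apply: eq_bigr => i _.
by rewrite -scalerAl !EZ gaussian_ibp mulrCA.
Qed.

(** Integration by parts trades one factor [linform x] for a derivative along
    [x]. It falls either on a power of the linear form, lowering [k] by two, or
    on [p]; the derivative of [p] along [x] is harmonic, and by Euler's identity
    it vanishes at [x] too. So the induction on [k] must run over all harmonic
    [p] that vanish at [x]. *)
Lemma gaussian_linformX x k : forall l p, harmonic l p -> meval x p = 0 ->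
  E (linform x ^+ k * p) = 0.
Proof.
have [N] := ubnP k; elim: N k => // N IH k kN l p hp px0.
case: k kN => [|k] kN.
  rewrite expr0 mul1r; case: l hp => [|l] hp; last exact: gaussian_mean0 hp.
  have pC : p = mpolyC n (p@_(mnm0)).
    apply/mpolyP => m; rewrite mcoeffC.
    have [->|m0] := eqVneq m mnm0; first by rewrite mulr1.
    by rewrite mulr0; case: hp => /homogP ->//; rewrite mdeg_eq0.
  by move: px0; rewrite pC mevalC => ->; rewrite mpolyC0 E0.
rewrite exprS -mulrA gaussian_linformM.
have -> : dderiv x (linform x ^+ k * p) =
    (k%:R * \sum_(i < n) x i ^+ 2) *: (linform x ^+ k.-1 * p)
    + linform x ^+ k * dderiv x p.
  rewrite mulr_sumr scaler_suml mulr_sumr -big_split /=; apply: eq_bigr => i _.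
  rewrite mderivM scalerDr mderiv_linformX -(scalerAl _ (linform x ^+ k.-1)).
  rewrite (scalerA (x i)) -(scalerAr (x i) (linform x ^+ k)).
  by congr (_ *: _ + _); rewrite mulrA -expr2 mulrC.
rewrite ED EZ.
rewrite (IH k.-1 _ l)//; last first.
  by rewrite (leq_ltn_trans (leq_pred _)).
rewrite (IH k _ l.-1) ?mulr0 ?addr0 ?mulr0//.
  exact: harmonic_dderiv.
by rewrite (euler_meval _ (proj1 hp)) px0 mulr0.
Qed.

Lemma mnm_pos m : (0 < mdeg m)%N -> exists i m', m = mnm_add (mnm1 i) m'.
Proof.
move=> m0; have [i mi] : exists i, m i != 0%N.
  apply/existsP; apply: contraTT m0; rewrite negb_exists => /forallP mi.
  by rewrite -eqn0Ngt mdegE big1// => i _; apply/eqP; have := mi i; rewrite negbK.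
exists i, (mnm_sub m (mnm1 i)); rewrite addmC submK//; apply/mnm_lepP => j.
by rewrite mnm1E; case: eqP => // <-; rewrite lt0n.
Qed.

(** Each integration by parts removes a variable from the monomial and either
    differentiates [p], which stays harmonic, or lowers the monomial further.
    As [mdeg m < l], the monomial is exhausted while [p] still has positive
    degree, and [gaussian_mean0] applies. *)
Lemma gaussian_orthogonal m : forall l p, harmonic l p -> (mdeg m < l)%N ->
  E (mpolyX K m * p) = 0.
Proof.
have [N] := ubnP (mdeg m); elim: N m => // N IH m mN l p hp ml.
have [m0|m0] := posnP (mdeg m).
  have -> : m = mnm0 by apply/eqP; rewrite -mdeg_eq0 m0.
  by rewrite mpolyX0 mul1r; apply: gaussian_mean0 hp; rewrite (leq_ltn_trans _ ml).
have [i [m' mE]] := mnm_pos m0.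
move: mN ml; rewrite mE mdegD mdeg1 add1n => mN ml.
rewrite mpolyXD -mulrA gaussian_ibp mderivM mderivX -scalerAl.
rewrite ED EZ (IH _ _ l p)//; first last.
- exact: leq_ltn_trans (mdegB _ _) (ltnW ml).
- exact: leq_ltn_trans (mdegB _ _) mN.
rewrite (IH _ _ l.-1)//; last by rewrite -ltnS prednK// (ltn_trans _ ml).
  by rewrite mulr0 addr0 mulr0.
exact: harmonic_mderiv.
Qed.

(** Integrations by parts strip the monomial one variable at a time. The terms
    in which the monomial is differentiated vanish by [gaussian_orthogonal];
    what remains is a nonzero multiple of the coefficient of [p] at [m]. *)
Lemma gaussian_coef m : E 1 != 0 -> forall l p, harmonic l p -> mdeg m = l ->
  p@_m != 0 -> E (mpolyX K m * p) != 0.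
Proof.
move=> E1; have [N] := ubnP (mdeg m); elim: N m => // N IH m mN l p hp ml pm.
have [m0|m0] := posnP (mdeg m).
  have mE : m = mnm0 by apply/eqP; rewrite -mdeg_eq0 m0.
  have pC : p = p@_m *: 1.
    apply/mpolyP => m'; rewrite mcoeffZ mcoeff1 mE.
    have [->|m'0] := eqVneq m' mnm0; first by rewrite mulr1.
    by rewrite mulr0; case: hp => /homogP ->//; rewrite -ml m0 mdeg_eq0.
  rewrite mE mpolyX0 mul1r pC EZ mulf_neq0//.
have [i [m' mE]] := mnm_pos m0.
move: mN ml pm; rewrite mE mdegD mdeg1 add1n => mN ml pm.
rewrite mpolyXD -mulrA gaussian_ibp mderivM mderivX -scalerAl.
rewrite ED EZ (gaussian_orthogonal hp); last first.
  by rewrite -ml ltnS mdegB.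
rewrite mulr0 add0r mulf_neq0// ?invr_eq0 ?pnatr_eq0//.
apply: (IH _ _ l.-1) => //; [exact: harmonic_mderiv|by rewrite -ml|].
by rewrite mcoeff_mderiv addmC mulrn_eq0 negb_or.
Qed.

End gaussian_moments.

Definition mfact m : nat := \prod_(i < n) (m i)`!.

Lemma mfact_neq0 m : (mfact m)%:R != 0 :> K.
Proof. by rewrite pnatr_eq0 -lt0n prodn_gt0// => i; rewrite fact_gt0. Qed.

Lemma mfactS m i : mfact (mnm_add m (mnm1 i)) = ((m i).+1 * mfact m)%N.
Proof.
rewrite /mfact (bigD1 i)//= [in RHS](bigD1 i)//= mnmDE mnm1E eqxx addn1 factS.
rewrite mulnA; congr (_ * _)%N; apply: eq_bigr => j ji.
by rewrite mnmDE mnm1E eq_sym (negbTE ji) addn0.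
Qed.

(** When [M] lists the moments of a measure nu, this is the polynomial
    x |-> int (x . y)^k / k! dnu(y), expanded by the multinomial theorem. The
    division by [mfact m] makes differentiation a mere shift of [M]. *)
Definition divpow_coef k (M : multinom n -> K) m : K :=
  if mdeg m == k then M m / (mfact m)%:R else 0.

(** When [M] lists the moments of a measure nu, this is the polynomial
    x |-> int (x . y)^k / k! dnu(y), expanded by the multinomial theorem. The
    division by [mfact m] makes differentiation a mere shift of [M]. *)
Definition divpow k (M : multinom n -> K) : mpoly n K :=
  \sum_(m : bmultinom n k.+1)
    divpow_coef k M m *: mpolyX K m.

Lemma mcoeff_divpow k M m :
  (divpow k M)@_m = divpow_coef k M m.
Proof.
have [mk|mk] := ltnP (mdeg m) k.+1.
  exact: mcoeff_mpoly.
rewrite /divpow_coef gtn_eqF// linear_sum big1// => -[m' /= m'k] _.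
rewrite mcoeffZ mcoeffX; have [m'm|] := eqVneq m' m; last by rewrite mulr0.
by move: mk; rewrite -m'm leqNgt m'k.
Qed.

Lemma divpow_homog k M : homog k (divpow k M).
Proof.
by apply/homogP => m /negbTE mk; rewrite mcoeff_divpow /divpow_coef mk.
Qed.

Lemma divpow_eq0 M : (forall k, divpow k M = 0) -> forall m, M m = 0.
Proof.
move=> M0 m; have := mcoeff_divpow (mdeg m) M m.
rewrite M0 mcoeff0 /divpow_coef eqxx => /esym/eqP.
by rewrite mulf_eq0 invr_eq0 (negbTE (mfact_neq0 m)) orbF => /eqP.
Qed.

Lemma divpow_sum k I (r : seq I) (M : I -> multinom n -> K) :
  \sum_(i <- r) divpow k (M i) = divpow k (fun m => \sum_(i <- r) M i m).
Proof.
apply/mpolyP => m; rewrite linear_sum /= mcoeff_divpow.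
under eq_bigr do rewrite mcoeff_divpow.
by rewrite /divpow_coef; case: eqP => _; [rewrite mulr_suml|rewrite big1].
Qed.

Lemma divpowZ k c M : divpow k (fun m => c * M m) = c *: divpow k M.
Proof.
apply/mpolyP => m; rewrite mcoeffZ !mcoeff_divpow.
by rewrite /divpow_coef; case: eqP; rewrite ?mulr0// mulrA.
Qed.

Lemma mderiv_divpow i k M :
  (divpow k.+1 M)^`M(i) = divpow k (fun m => M (mnm_add m (mnm1 i))).
Proof.
apply/mpolyP => m; rewrite mcoeff_mderiv !mcoeff_divpow /divpow_coef mdegD mdeg1 addn1 eqSS.
case: eqP; rewrite ?mul0rn// => _.
rewrite mfactS natrM -[LHS]mulr_natr.
have : (m i).+1%:R != 0 :> K by rewrite pnatr_eq0.
by move=> mi; field; rewrite mfact_neq0 nat1r mi.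
Qed.

Lemma lap_divpow k M : lap (divpow k.+2 M) =
  divpow k (fun m => \sum_(i < n) M (mnm_add (mnm_add m (mnm1 i)) (mnm1 i))).
Proof.
by rewrite -divpow_sum; apply: eq_bigr => i _; rewrite !mderiv_divpow.
Qed.

Lemma homog1_lap p : homog 1 p -> lap p = 0.
Proof.
by move=> p1; rewrite /lap big1// => i _; exact: homog0_deriv (homog_mderiv _ p1).
Qed.

Lemma homog0_lap p : homog 0 p -> lap p = 0.
Proof.
by move=> p0; rewrite /lap big1// => i _; rewrite (homog0_deriv _ p0) mderiv0.
Qed.

(** The hypothesis on [M] says that the Laplacian sends [divpow k.+2 M] to
    [divpow k M], so that the first nonzero term of the sequence is harmonic. *)
Lemma divpow_first_harmonic M :
  (forall m, \sum_(i < n) M (mnm_add (mnm_add m (mnm1 i)) (mnm1 i)) = M m) ->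
  (exists k, divpow k M != 0) ->
  exists k, divpow k M != 0 /\ lap (divpow k M) = 0.
Proof.
move=> MS M0; case: (ex_minnP M0) => k k0 kmin; exists k; split=> //.
case: k k0 kmin => [|[|k]] k0 kmin.
- exact: homog0_lap (divpow_homog _ _).
- exact: homog1_lap (divpow_homog _ _).
rewrite lap_divpow (_ : (fun m => _) = M); last exact/funext.
apply/eqP; apply/negPn/negP => /kmin.
by rewrite ltnNge leqnSn.
Qed.

Lemma meval_divpow x k M : meval x (divpow k M) =
  \sum_(m : bmultinom n k.+1)
    divpow_coef k M m * \prod_(i < n) x i ^+ m i.
Proof.
by rewrite raddf_sum; apply: eq_bigr => m _; rewrite /= mevalZ mevalX.
Qed.

(** The multinomial theorem. By Euler's identity, [k.+1] times the left-hand
    side in degree [k.+1] is a derivative along [x], that is a shift of the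
    exponents of [y], which produces the missing factor. *)
Lemma meval_divpow_exp x y k :
  meval x (divpow k (fun m => \prod_(i < n) y i ^+ m i)) =
  (\sum_(i < n) x i * y i) ^+ k / k`!%:R.
Proof.
elim: k => [|k IH].
  rewrite expr0 divr1 (_ : divpow 0 _ = 1) ?meval1//.
  apply/mpolyP => m; rewrite mcoeff_divpow /divpow_coef mcoeff1 mdeg_eq0.
  have [->|//] := eqVneq m mnm0; rewrite /mfact.
  rewrite big1 => [|i _]; last by rewrite mnm0E expr0.
  by rewrite big1 ?divr1// => i _; rewrite mnm0E.
have k1 : k.+1%:R != 0 :> K by rewrite pnatr_eq0.
apply: (mulfI k1); rewrite -(euler_meval _ (divpow_homog _ _)).
rewrite /dderiv raddf_sum /=.
under eq_bigr => i _.
  rewrite mevalZ mderiv_divpow.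
  rewrite (_ : (fun m => _) = (fun m => y i * \prod_(j < n) y j ^+ m j)).
    rewrite divpowZ mevalZ IH mulrA; over.
  apply/funext => m; rewrite (bigD1 i)//= [in RHS](bigD1 i)//= mulrA.
  rewrite mnmDE mnm1E eqxx addn1 exprS; congr (_ * _).
  by apply: eq_bigr => j ji; rewrite mnmDE mnm1E eq_sym (negbTE ji) addn0.
rewrite -mulr_suml exprS factS natrM.
have k2 : k`!%:R != 0 :> K by rewrite pnatr_eq0 -lt0n fact_gt0.
by field; rewrite k2 nat1r k1.
Qed.

End harmonic_algebra.

End HarmonicAlgebra.

(** * Integrals against a charge *)

Section charge_integral_theory.
Context d (T : measurableType d) (R : realType) (nu : {charge set T -> \bar R}).
Variables (D : set T) (mD : measurable D).
Implicit Types f g : T -> R.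

(** The bound is required on [D] only: with [D] the unit sphere, all polynomials
    qualify. *)
Definition bounded_measurable f :=
  measurable_fun setT f /\ exists M, forall x, D x -> `|f x| <= M.

Lemma bounded_measurable_integrable (mu : {finite_measure set T -> \bar R}) f :
  bounded_measurable f -> mu.-integrable D (EFin \o f).
Proof.
move=> [mf [M fM]]; apply: measurable_bounded_integrable => //.
- by rewrite ltey_eq fin_num_measure.
- exact: measurable_funTS.
- by exists M; split; [exact: num_real|move=> N MN x Dx; apply: (le_trans (fM _ Dx)); exact: ltW].
Qed.

Lemma bounded_measurable_cst c : bounded_measurable (cst c).
Proof. by split; [exact: measurable_cst|exists `|c|]. Qed.

Lemma bounded_measurableD f g : bounded_measurable f -> bounded_measurable g ->
  bounded_measurable (fun x => f x + g x).
Proof.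
move=> [mf [M fM]] [mg [N gN]]; split; first exact: measurable_funD.
by exists (M + N) => x Dx; rewrite (le_trans (ler_normD _ _))// lerD ?fM ?gN.
Qed.

Lemma bounded_measurableM f g : bounded_measurable f -> bounded_measurable g ->
  bounded_measurable (fun x => f x * g x).
Proof.
move=> [mf [M fM]] [mg [N gN]]; split; first exact: measurable_funM.
by exists (M * N) => x Dx; rewrite normrM ler_pM ?fM ?gN.
Qed.

Lemma bounded_measurable_sum I (r : seq I) (F : I -> T -> R) :
  (forall i, bounded_measurable (F i)) ->
  bounded_measurable (fun x => \sum_(i <- r) F i x).
Proof.
move=> bF; elim: r => [|i r IH].
  by under eq_fun do rewrite big_nil; exact: (bounded_measurable_cst 0).
by under eq_fun do rewrite big_cons; exact: bounded_measurableD.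
Qed.

Lemma bounded_measurable_prod I (r : seq I) (F : I -> T -> R) :
  (forall i, bounded_measurable (F i)) ->
  bounded_measurable (fun x => \prod_(i <- r) F i x).
Proof.
move=> bF; elim: r => [|i r IH].
  by under eq_fun do rewrite big_nil; exact: (bounded_measurable_cst 1).
by under eq_fun do rewrite big_cons; exact: bounded_measurableM.
Qed.

Lemma bounded_measurableX f k : bounded_measurable f ->
  bounded_measurable (fun x => f x ^+ k).
Proof.
move=> bf; elim: k => [|k IH]; first exact: (bounded_measurable_cst 1).
by under eq_fun do rewrite exprS; exact: bounded_measurableM.
Qed.

Let jp := jordan_pos (svalP (cid (svalP (cid (Hahn_decomposition nu))))).
Let jn := jordan_neg (svalP (cid (svalP (cid (Hahn_decomposition nu))))).

Let charge_integralE f :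
  charge_integral nu D f = \int[jp]_(x in D) f x - \int[jn]_(x in D) f x.
Proof. by []. Qed.

Lemma eq_charge_integral f g : (forall x, D x -> f x = g x) ->
  charge_integral nu D f = charge_integral nu D g.
Proof.
move=> fg; rewrite !charge_integralE.
by congr (_ - _); apply: eq_Rintegral => x; rewrite inE => /fg.
Qed.

Lemma charge_integralD f g : bounded_measurable f -> bounded_measurable g ->
  charge_integral nu D (fun x => f x + g x) =
  charge_integral nu D f + charge_integral nu D g.
Proof.
move=> bf bg; rewrite !charge_integralE !RintegralD//; first by ring.
all: exact: bounded_measurable_integrable.
Qed.

Lemma charge_integralZ c f : bounded_measurable f ->
  charge_integral nu D (fun x => c * f x) = c * charge_integral nu D f.
Proof.
move=> bf; rewrite !charge_integralE !RintegralZl//; first by ring.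
all: exact: bounded_measurable_integrable.
Qed.

Lemma charge_integral_sum I (r : seq I) (F : I -> T -> R) :
  (forall i, bounded_measurable (F i)) ->
  charge_integral nu D (fun x => \sum_(i <- r) F i x) =
  \sum_(i <- r) charge_integral nu D (F i).
Proof.
move=> bF; elim: r => [|i r IH].
  rewrite big_nil; under eq_charge_integral do rewrite big_nil.
  rewrite (@eq_charge_integral _ (fun x => 0 * 0)) => [|x _]; last by rewrite mul0r.
  by rewrite (charge_integralZ 0 (bounded_measurable_cst 0)) mul0r.
rewrite big_cons -IH -charge_integralD//; last exact: bounded_measurable_sum.
by apply: eq_charge_integral => x _; rewrite big_cons.
Qed.

(** Both Jordan parts are finite measures, so that a constant is a dominating
    function. *)
Lemma charge_integral_cvg (F : nat -> T -> R) f M :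
  (forall k, measurable_fun setT (F k)) -> measurable_fun setT f ->
  (forall k x, D x -> `|F k x| <= M) ->
  (forall x, D x -> F k x @[k --> \oo] --> f x) ->
  charge_integral nu D (F k) @[k --> \oo] --> charge_integral nu D f.
Proof.
move=> mF mf FM Ff.
have bF k : bounded_measurable (F k) by split => //; exists M; exact: FM.
have cvgm (m : {finite_measure set T -> \bar R}) :
    \int[m]_(x in D) F k x @[k --> \oo] --> \int[m]_(x in D) f x.
  have Mi : m.-integrable D (cst M%:E).
    exact: (bounded_measurable_integrable m (bounded_measurable_cst M)).
  have [||||fi _ H] := @dominated_convergence _ _ _ m D mD
    (fun k => EFin \o F k) (EFin \o f) (cst M%:E) _ _ _ Mi _.
  - by move=> k; apply/measurable_EFinP; exact: measurable_funTS.
  - by apply/measurable_EFinP; exact: measurable_funTS.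
  - by apply: aeW => x Dx; apply: cvg_EFin; [exact: nearW|exact: Ff].
  - by apply: aeW => x k Dx /=; rewrite lee_fin FM.
  rewrite /Rintegral; apply: fine_cvg.
  rewrite fineK; last exact: integrable_fin_num.
  exact: H.
rewrite charge_integralE; apply: cvgB; [exact: (cvgm jp)|exact: (cvgm jn)].
Qed.

Lemma charge_integral_indic A : measurable A ->
  charge_integral nu D \1_A = fine (nu (A `&` D)).
Proof.
move=> mA; rewrite charge_integralE /Rintegral !integral_indic//.
rewrite [in RHS](jordan_decomp (svalP (cid (svalP (cid (Hahn_decomposition nu))))))//;
  last exact: measurableI.
rewrite /cadd/= cscaleN1 -/jp -/jn fineB//; apply: fin_num_measure; exact: measurableI.
Qed.

End charge_integral_theory.

Section charge_integral_moments.
Context d (T : measurableType d) (R : realType) (nu : {charge set T -> \bar R}).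
Variables (D : set T) (mD : measurable D).
Variables (s : T -> R) (bs : bounded_measurable D s).

Lemma lipschitz1 (f df : R -> R) (x y : R) :
  (forall z : R, is_derive z (1 : R) f (df z)) -> (forall z, `|df z| <= 1) ->
  `|f y - f x| <= `|y - x|.
Proof.
move=> fdf df1; wlog xy : x y / x <= y.
  move=> H; have [|/ltW] := leP x y; first exact: H.
  by rewrite distrC (distrC y); exact: H.
have cf : {within `[x, y], continuous f}.
  apply: continuous_subspaceT => z; apply: differentiable_continuous.
  by apply/derivable1_diffP; case: (fdf z).
have [c _ ->] := MVT_segment xy (fun z _ => fdf z) cf.
by rewrite normrM ler_piMl.
Qed.

(** Differentiation in [t] under the integral sign: the difference quotients of
    [f] are bounded by the Lipschitz constant. The weight [w] makes the lemma
    iterable, and the hypotheses on [f] hold for the sine and the cosine. *)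
Lemma charge_integral_derive (f df : R -> R) (w : T -> R) :
  (forall z : R, is_derive z (1 : R) f (df z)) -> (forall z, `|df z| <= 1) ->
  (forall z, `|f z| <= 1) ->
  measurable_fun setT f -> measurable_fun setT df ->
  bounded_measurable D w ->
  (forall t, charge_integral nu D (fun x => w x * f (t * s x)) = 0) ->
  forall t, charge_integral nu D (fun x => w x * s x * df (t * s x)) = 0.
Proof.
move=> fdf df1 f1 mf mdf [mw [Mw wM]] J0 t; have [ms [Ms sM]] := bs.
have mts u : measurable_fun setT (fun x => u * s x).
  by apply: measurable_funM => //; exact: measurable_cst.
(* A sequence of increments suffices, since t is fixed and the limit is known
   to exist. *)
pose h k : R := k.+1%:R^-1.
pose F k x := w x * ((f ((t + h k) * s x) - f (t * s x)) / h k).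
have h0 k : 0 < h k by rewrite invr_gt0 ltr0n.
have mfs u : measurable_fun setT (fun x => f (u * s x)).
  exact: measurableT_comp.
have mF k : measurable_fun setT (F k).
  apply: measurable_funM => //; apply: measurable_funM; last exact: measurable_cst.
  exact: measurable_funB.
have FM k x : D x -> `|F k x| <= Mw * Ms.
  move=> Dx; rewrite normrM ler_pM ?wM// normrM (gtr0_norm (_ : 0 < (h k)^-1)); last first.
    by rewrite invr_gt0.
  rewrite ler_pdivrMr// (le_trans (lipschitz1 _ _ fdf df1))//.
  by rewrite -mulrBl addrAC subrr add0r normrM gtr0_norm// mulrC ler_wpM2r ?sM// ltW.
have Fl x : D x -> F k x @[k --> \oo] --> w x * s x * df (t * s x).
  move=> Dx; rewrite -mulrA; apply: cvgM; first exact: cvg_cst.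
  set y := t * s x; set v := s x.
  have dfy : differentiable f (y : R^o) by apply/derivable1_diffP; case: (fdf y).
  have Dv : derive f y v = v * df y.
    rewrite deriveE// -[in LHS](mulr1 v) -[in LHS]/(v *: 1) linearZ/= -deriveE//.
    by rewrite derive_val.
  have Hd : (fun e => e^-1 *: ((f \o shift y) (e *: v) - f y)) @ 0^' --> v * df y.
    by rewrite -Dv; exact: (@diff_derivable _ _ _ f y v dfy).
  have := cvg_dnbhs_at_right Hd; rewrite cvg_at_rightP => /(_ h).
  have h00 : h k @[k --> \oo] --> 0 by exact: cvg_harmonic.
  move=> /(_ (conj h0 h00)).
  apply: cvg_trans; apply: near_eq_cvg; near=> k.
  by rewrite /= /GRing.scale/= -mulrDl mulrC (addrC t).
have H : charge_integral nu D (F k) @[k --> \oo] --> charge_integral nu D (fun x => w x * s x * df (t * s x)).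
  apply: (@charge_integral_cvg _ _ _ nu D mD F
    (fun x => w x * s x * df (t * s x)) (Mw * Ms)) => //.
  apply: measurable_funM; first exact: measurable_funM.
  exact: measurableT_comp.
rewrite -(cvg_lim _ H)// (_ : (fun k => _) = cst 0); first exact: lim_cst.
apply/funext => k.
rewrite /= (_ : F k = (fun x => (h k)^-1 * (w x * f ((t + h k) * s x)) +
    - (h k)^-1 * (w x * f (t * s x)))); last by apply/funext => x; rewrite /F; ring.
have bwf u : bounded_measurable D (fun x => w x * f (u * s x)).
  apply: bounded_measurableM; first by split => //; exists Mw.
  by split => //; exists 1.
rewrite charge_integralD ?charge_integralZ// ?J0 ?mulr0 ?addr0//.
  exact: bounded_measurableM (bounded_measurable_cst _ _) (bwf _).
exact: bounded_measurableM (bounded_measurable_cst _ _) (bwf _).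
Unshelve. all: by end_near. Qed.

(** Differentiate [k] times in [t] and put [t = 0]. The sine and the cosine are
    treated together because differentiation exchanges them. *)
Lemma charge_integral_moments :
  (forall t, charge_integral nu D (fun x => cos (t * s x)) = 0) ->
  (forall t, charge_integral nu D (fun x => sin (t * s x)) = 0) ->
  forall k, charge_integral nu D (fun x => s x ^+ k) = 0.
Proof.
move=> C0 S0 k.
have mc : measurable_fun setT (@cos R).
  by apply: continuous_measurable_fun; exact: continuous_cos.
have ms : measurable_fun setT (@sin R).
  by apply: continuous_measurable_fun; exact: continuous_sin.
have cos1 z : `|cos z : R| <= 1 by rewrite ler_norml cos_geN1 cos_le1.
have sin1 z : `|sin z : R| <= 1 by rewrite ler_norml sin_geN1 sin_le1.
suff [+ _] : (forall t, charge_integral nu D (fun x => s x ^+ k * cos (t * s x)) = 0)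
    /\ (forall t, charge_integral nu D (fun x => s x ^+ k * sin (t * s x)) = 0).
  by move=> /(_ 0) <-; apply: eq_charge_integral => x _; rewrite mul0r cos0 mulr1.
elim: k => [|k [IHc IHs]].
  split=> t; [rewrite -[RHS](C0 t)|rewrite -[RHS](S0 t)];
    by apply: eq_charge_integral => x _; rewrite expr0 mul1r.
have bk : bounded_measurable D (fun x => s x ^+ k) by exact: bounded_measurableX.
have bcs (f : R -> R) : measurable_fun setT f -> (forall z : R, `|f z| <= 1) ->
    forall t, bounded_measurable D (fun x => f (t * s x)).
  move=> mf f1 t; split; last by exists 1.
  apply: measurableT_comp => //.
  by apply: measurable_funM; [exact: measurable_cst|case: bs].
split=> t.
  rewrite -[RHS](@charge_integral_derive sin cos (fun x => s x ^+ k) _ _ _ _ _ _ _ t)//.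
  by apply: eq_charge_integral => x _; rewrite exprSr.
have := @charge_integral_derive cos (fun z => - sin z) (fun x => s x ^+ k) _ _ _ _ _ _ _ t.
move=> H; rewrite -[RHS](mulr0 (-1)) -{}H//; last 2 first.
- by move=> z; rewrite normrN.
- exact: measurableT_comp.
rewrite -charge_integralZ//.
  by apply: eq_charge_integral => x _; rewrite exprSr; ring.
apply: bounded_measurableM; first exact: bounded_measurableM.
apply: (bcs (fun z => - sin z)); first exact: measurableT_comp.
by move=> z; rewrite normrN.
Qed.

End charge_integral_moments.

(** * Moments of a charge on the sphere *)

Section step_polynomials.
Context (R : realType).
Implicit Types (a x : R) (m : nat).

(** An explicit approximation of the indicator of x < a on [-1, 1]. The affine
    function u takes its values in [0, 1] and crosses 1/2 at [a]. The exponent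
    m 2^m is such that m 2^m u^m = m (2 u)^m tends to 0 when u < 1/2, and to
    infinity when u >= 1/2; the factor m settles the case u = 1/2. *)
Definition step_poly a m : {poly R} :=
  let u := (2^-1)%:P + (2 * (1 + `|a|))^-1 *: ('X - a%:P) in
  (1 - u ^+ m) ^+ (m * 2 ^ m).

Let stepu a x : R := 2^-1 + (2 * (1 + `|a|))^-1 * (x - a).

Let step_polyE a m x : (step_poly a m).[x] = (1 - stepu a x ^+ m) ^+ (m * 2 ^ m).
Proof. by rewrite /step_poly /stepu !hornerE. Qed.

Let stepu_itv a x : `|x| <= 1 -> 0 <= stepu a x <= 1.
Proof.
move=> x1; have a0 : 0 < 1 + `|a| by rewrite ltr_pwDl.
have : `|x - a| <= 1 + `|a| by rewrite (le_trans (ler_normB _ _))// lerD2r.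
rewrite ler_norml => /andP[xa xa'].
have c0 : 0 < (2 * (1 + `|a|))^-1 by rewrite invr_gt0 mulr_gt0.
have cE : (2 * (1 + `|a|))^-1 * (1 + `|a|) = 2^-1.
  by field; rewrite gt_eqF.
have := ler_wpM2l (ltW c0) xa; have := ler_wpM2l (ltW c0) xa'.
rewrite mulrN cE /stepu => ? ?; apply/andP; split; lra.
Qed.

Lemma step_poly_itv a m x : `|x| <= 1 -> 0 <= (step_poly a m).[x] <= 1.
Proof.
move=> /stepu_itv-/(_ a)/andP[u0 u1]; rewrite step_polyE.
have um1 : stepu a x ^+ m <= 1 by exact: exprn_ile1.
by rewrite exprn_ge0 ?subr_ge0// exprn_ile1 ?subr_ge0// gerBl exprn_ge0.
Qed.

Let bernoulli (y : R) N : -1 <= y -> 1 + N%:R * y <= (1 + y) ^+ N.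
Proof.
move=> y1; elim: N => [|N IH]; first by rewrite mul0r addr0 expr0.
have y0 : 0 <= 1 + y by lra.
rewrite exprS (le_trans _ (ler_wpM2l y0 IH))//.
rewrite -natr1; have : 0 <= N%:R * y ^+ 2 by rewrite mulr_ge0// sqr_ge0.
by lra.
Qed.

Let cvg_nXn (q : R) : 0 <= q < 1 -> m%:R * q ^+ m @[m --> \oo] --> 0.
Proof.
move=> /andP[q0 q1].
(* With q = r^2, the product is (m r^m) r^m, and m r^m is bounded by
   Bernoulli's inequality for powers of 1/r. *)
have [->|q_neq0] := eqVneq q 0.
  apply: cvg_near_cst; near=> m.
  by rewrite expr0n gtn_eqF ?mulr0//; near: m; exact: nbhs_infty_gt.
have q_gt0 : 0 < q by rewrite lt_def q_neq0.
pose r := Num.sqrt q; pose h := r^-1 - 1.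
have r0 : 0 < r by rewrite sqrtr_gt0.
have r1 : r < 1 by rewrite -sqrtr1 ltr_sqrt.
have h0 : 0 < h by rewrite subr_gt0 invf_gt1.
apply: (@squeeze_cvgr _ _ _ _ (cst 0) (fun m => h^-1 * r ^+ m)).
- apply: nearW => m /=; rewrite mulr_ge0//= ?exprn_ge0//.
  rewrite -(sqr_sqrtr q0) -/r exprAC [X in _ * X]expr2 mulrA ler_wpM2r ?exprn_ge0 ?(ltW r0)//.
  rewrite -ler_pdivlMr ?exprn_gt0// -ler_pdivrMl ?invr_gt0// invrK mulrC.
  have h1 : 1 + h = r^-1 by rewrite /h addrC subrK.
  have := @bernoulli h m; rewrite h1 exprVn => H.
  by rewrite (le_trans _ (H _))//; lra.
- exact: cvg_cst.
- rewrite -[X in _ --> X](mulr0 h^-1); apply: cvgM; first exact: cvg_cst.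
  by apply: cvg_expr; rewrite gtr0_norm.
Unshelve. all: by end_near. Qed.

(** Write v = u^m and N = m 2^m. If u < 1/2, Bernoulli's inequality gives
    (1 - v)^N >= 1 - m (2 u)^m. If u >= 1/2, then (1 - v)^N (1 + v)^N <= 1 and,
    by Bernoulli again, (1 + v)^N >= 1 + m. *)
Lemma step_poly_cvg a x : `|x| <= 1 ->
  (step_poly a m).[x] @[m --> \oo] --> ((x < a)%R%:R : R).
Proof.
move=> x1; have /andP[u0 u1] := @stepu_itv a x x1.
have a0 : 0 < (2 * (1 + `|a|))^-1 by rewrite invr_gt0 mulr_gt0// ltr_pwDl.
have [xa|ax] := ltP x a.
  have uh : 2 * stepu a x < 1.
    have : (2 * (1 + `|a|))^-1 * (x - a) < 0 by rewrite pmulr_rlt0// subr_lt0.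
    by rewrite /stepu => ?; lra.
  apply: (@squeeze_cvgr _ _ _ _ (fun m => 1 - m%:R * (2 * stepu a x) ^+ m) (cst 1)).
  - apply: nearW => m; rewrite (andP (step_poly_itv a m x1)).2 andbT.
    rewrite step_polyE (le_trans _ (bernoulli _ _))//; last first.
      by rewrite lerN2; exact: exprn_ile1.
    by rewrite mulrN natrM natrX exprMn mulrA.
  - rewrite -[X in _ --> X]subr0; apply: cvgB; first exact: cvg_cst.
    by apply: cvg_nXn; rewrite mulr_ge0.
  - exact: cvg_cst.
have uh : 1 <= 2 * stepu a x.
  have : 0 <= (2 * (1 + `|a|))^-1 * (x - a) by rewrite mulr_ge0 ?subr_ge0// ltW.
  by rewrite /stepu => ?; lra.
apply: (@squeeze_cvgr _ _ _ _ (cst 0) harmonic).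
- apply: nearW => m; rewrite (andP (step_poly_itv a m x1)).1/= step_polyE.
  set v := stepu a x ^+ m; set N := (m * 2 ^ m)%N.
  have v0 : 0 <= v by exact: exprn_ge0.
  have v1 : v <= 1 by exact: exprn_ile1.
  have H : (1 - v) ^+ N * (1 + v) ^+ N <= 1.
    by rewrite -exprMn exprn_ile1//; [rewrite mulr_ge0; lra|nra].
  have mN : m.+1%:R <= (1 + v) ^+ N.
    rewrite (le_trans _ (bernoulli _ _)) ?(le_trans _ v0)//.
    rewrite -nat1r lerD2l natrM natrX -mulrA -exprMn ler_peMr//.
    exact: exprn_ege1.
  rewrite /= -[leRHS]mul1r ler_pdivlMr//.
  apply: le_trans H; apply: ler_wpM2l => //.
  by rewrite exprn_ge0// subr_ge0.
- exact: cvg_cst.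
- exact: cvg_harmonic.
Qed.

End step_polynomials.

Section boxes.
Context (R : realType) (n : nat).

Definition lower_box (a : n.-tuple R) : set (n.-tuple R) :=
  [set x | forall i, tnth x i < tnth a i].

Definition lower_boxes : set (set (n.-tuple R)) := range lower_box.

Lemma lower_boxE a x : x \in lower_box a = [forall i, tnth x i < tnth a i].
Proof.
by apply/idP/forallP => [/set_mem //|xa]; apply: mem_set => i; exact: xa.
Qed.

Lemma lower_box_bigcap a :
  lower_box a = \bigcap_(i in [set: 'I_n]) ((@tnth n R)^~ i @^-1` `]-oo, tnth a i[).
Proof.
apply/seteqP; split=> x /= xa i; first by rewrite /= in_itv /=.
by have := xa i Logic.I; rewrite /= in_itv.
Qed.

Lemma measurable_lower_box a : measurable (lower_box a).
Proof.
rewrite lower_box_bigcap; apply: fin_bigcap_measurable => // i _.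
rewrite -[X in measurable X]setTI.
by apply: (@measurable_tnth _ R n i) => //; exact: measurable_itv.
Qed.

Lemma lower_boxes_setI : setI_closed lower_boxes.
Proof.
move=> _ _ [a _ <-] [b _ <-].
exists [tuple Num.min (tnth a i) (tnth b i) | i < n] => //.
apply/seteqP; split=> x.
  by move=> xab; split=> i; have := xab i; rewrite tnth_mktuple lt_min => /andP[].
by move=> [xa xb] i; rewrite tnth_mktuple lt_min xa xb.
Qed.

Definition cube k : set (n.-tuple R) := lower_box [tuple k%:R | i < n].

Lemma cube_cover : \bigcup_k cube k = setT.
Proof.
apply/seteqP; split=> // x _.
exists (Num.truncn (\sum_(i < n) `|tnth x i|)).+1 => // i.
rewrite tnth_mktuple; apply: le_lt_trans (truncnS_gt _).
rewrite (le_trans (ler_norm _))// (bigD1 i)//= lerDl.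
by apply: sumr_ge0.
Qed.

Lemma lower_boxes_measurable : measurable = <<s lower_boxes >>.
Proof.
apply/seteqP; split=> [A mA|]; last first.
  apply: smallest_sub; first exact: sigma_algebra_measurable.
  by move=> _ [a _ <-]; exact: measurable_lower_box.
pose T := g_sigma_algebraType lower_boxes.
suff mid : measurable_fun [set: T] (fun x : T => (x : n.-tuple R)).
  by have := mid measurableT A mA; rewrite setTI.
apply/measurable_fun_tnthP => i.
apply: (measurability _ (RGenInftyO.measurableE R)) => _ [_ [y ->] <-].
rewrite setTI.
rewrite (_ : _ @^-1` _ =
    \bigcup_k lower_box [tuple if j == i then y else k%:R | j < n]).
  apply: bigcupT_measurable => k; apply: sub_sigma_algebra.
  by exists [tuple if j == i then y else k%:R | j < n].
(* Only the i-th coordinate is constrained, and the other sides grow with k. *)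
apply/seteqP; split=> [x /= |x [k _ xk] /=].
  rewrite in_itv/= => xy.
  have [k _ xk] : (\bigcup_k cube k) (x : n.-tuple R) by rewrite cube_cover.
  exists k => // j; rewrite tnth_mktuple; case: eqP => [->//|_].
  by have := xk j; rewrite tnth_mktuple.
by have := xk i; rewrite tnth_mktuple eqxx in_itv.
Qed.

End boxes.

Section unit_sphere_theory.
Context (R : realType) (n : nat).
Local Notation S := (@unit_sphere R n).
Implicit Types x : n.-tuple R.

Lemma dotv_ge0 x : 0 <= dotv x x.
Proof. by apply: sumr_ge0 => i _; rewrite -expr2 sqr_ge0. Qed.

Lemma sqr_normv x : normv x ^+ 2 = dotv x x.
Proof. by rewrite sqr_sqrtr// dotv_ge0. Qed.

Lemma measurable_unit_sphere : measurable S.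
Proof.
rewrite (_ : S = @normv R n @^-1` [set 1])//.
rewrite -[X in measurable X]setTI.
exact: (@measurable_normv R n measurableT _ (measurable_set1 _)).
Qed.

Lemma coord_le_normv x i : `|tnth x i| <= normv x.
Proof.
rewrite -(sqrtr_sqr (tnth x i)) ler_sqrt ?dotv_ge0//.
rewrite /dotv (bigD1 i)//= -expr2 lerDl; apply: sumr_ge0 => j _.
by rewrite -expr2 sqr_ge0.
Qed.

Lemma bounded_measurable_coord i : bounded_measurable S ((@tnth n R)^~ i).
Proof.
split; first exact: measurable_tnth.
by exists 1 => x Sx; rewrite (le_trans (coord_le_normv x i))// Sx.
Qed.

Lemma bounded_measurable_dotv xi : bounded_measurable S (dotv xi).
Proof.
apply: bounded_measurable_sum => i; apply: bounded_measurableM.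
  exact: bounded_measurable_cst.
exact: bounded_measurable_coord.
Qed.

Lemma bounded_measurable_monomial (k : 'I_n -> nat) :
  bounded_measurable S (fun x => \prod_(i < n) tnth x i ^+ k i).
Proof.
apply: bounded_measurable_prod => i; apply: bounded_measurableX.
exact: bounded_measurable_coord.
Qed.

Section moment_problem.
Variable nu : {charge set (n.-tuple R) -> \bar R}.
Hypothesis nu0 : forall k : 'I_n -> nat,
  charge_integral nu S (fun x => \prod_(i < n) tnth x i ^+ k i) = 0.

Lemma charge_integral_poly_prod (p : 'I_n -> {poly R}) :
  charge_integral nu S (fun x => \prod_(i < n) (p i).[tnth x i]) = 0.
Proof.
pose N := \max_(i < n) size (p i).
transitivity (charge_integral nu S (fun x => \sum_(f : {ffun 'I_n -> 'I_N})
    (\prod_(i < n) (p i)`_(f i)) * \prod_(i < n) tnth x i ^+ f i)).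
  apply: eq_charge_integral => x _.
  under eq_bigr => i _ do rewrite (@horner_coef_wide _ N) ?leq_bigmax//.
  rewrite bigA_distr_bigA/=; apply: eq_bigr => f _.
  by rewrite big_split.
rewrite charge_integral_sum; last 2 first.
- exact: measurable_unit_sphere.
- move=> f; apply: bounded_measurableM; first exact: bounded_measurable_cst.
  exact: (bounded_measurable_monomial (fun i => f i)).
apply: big1 => f _; rewrite charge_integralZ; first by rewrite nu0 mulr0.
- exact: measurable_unit_sphere.
- exact: (bounded_measurable_monomial (fun i => f i)).
Qed.

(** On the sphere, the indicator of a box is the bounded pointwise limit of
    products of the polynomials [step_poly], one for each coordinate. *)
Lemma charge_integral_lower_box a : charge_integral nu S \1_(lower_box a) = 0.
Proof.
pose F m x := \prod_(i < n) (step_poly (tnth a i) m).[tnth x i].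
have mF m : measurable_fun setT (F m).
  apply: (@measurable_prod _ _ R setT 'I_n (index_enum _)
    (fun i x => (step_poly (tnth a i) m).[tnth x i])) => i _.
  apply: (@measurableT_comp _ _ _ _ _ _ (horner (step_poly (tnth a i) m))).
    by apply: continuous_measurable_fun; exact: continuous_horner.
  exact: measurable_tnth.
have F01 m x : S x -> 0 <= F m x <= 1.
  move=> Sx; have p01 i : 0 <= (step_poly (tnth a i) m).[tnth x i] <= 1.
    by apply: step_poly_itv; rewrite (le_trans (coord_le_normv _ _))// Sx.
  by rewrite prodr_ge0 ?prodr_ile1// => i _; case/andP: (p01 i).
have H : charge_integral nu S (F m) @[m --> \oo] --> charge_integral nu S \1_(lower_box a).
  apply: (@charge_integral_cvg _ _ _ nu S measurable_unit_sphere F _ 1 mF) => //.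
  - by apply: measurable_indic; exact: measurable_lower_box.
  - by move=> m x Sx; have /andP[F0 F1] := F01 m x Sx; rewrite ger0_norm.
  - move=> x Sx.
    rewrite indicE lower_boxE.
    rewrite (_ : _%:R = \prod_(i < n) ((tnth x i < tnth a i)%R%:R : R)).
      apply: (@cvg_big R 'I_n *%R 1 xpredT (@mul_continuous R)) => i _.
      by apply: step_poly_cvg; rewrite (le_trans (coord_le_normv _ _))// Sx.
    have [/forallP xa|] := boolP [forall i, tnth x i < tnth a i].
      by rewrite big1// => i _; rewrite xa.
    rewrite negb_forall => /existsP[i xa].
    by rewrite (bigD1 i)//= (negbTE xa) mul0r.
rewrite -(cvg_lim _ H)//.
rewrite (_ : (fun _ => _) = cst 0); first exact: lim_cst.
by apply/funext => m; exact: charge_integral_poly_prod.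
Qed.

(** The two Jordan parts of [nu] agree on the traces of the lower boxes, which
    are stable under intersection and generate the Borel sets, so they agree. *)
Lemma charge_moments_eq0 A : measurable A -> nu (A `&` S) = 0%E.
Proof.
move=> mA; have mS := measurable_unit_sphere.
pose HD := svalP (cid (svalP (cid (Hahn_decomposition nu)))).
have nuE B : measurable B -> nu (B `&` S) =
    (jordan_pos HD (B `&` S) - jordan_neg HD (B `&` S))%E.
  move=> mB; rewrite (jordan_decomp HD)//; last exact: measurableI.
  by rewrite /cadd/= cscaleN1.
have boxE B : lower_boxes B -> jordan_pos HD (B `&` S) = jordan_neg HD (B `&` S).
  move=> [a _ <-]; have mB := measurable_lower_box a.
  have fin (m : {finite_measure set (n.-tuple R) -> \bar R}) :
      m (lower_box a `&` S) \is a fin_num.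
    by apply: fin_num_measure; exact: measurableI.
  have := charge_integral_lower_box a.
  rewrite charge_integral_indic// nuE// fineB ?fin// => /eqP.
  rewrite subr_eq0 => /eqP jpn.
  by rewrite -[LHS]fineK ?fin// -[RHS]fineK ?fin// jpn.
suff : mrestr (jordan_pos HD) mS A = mrestr (jordan_neg HD) mS A.
  by rewrite /mrestr nuE// => ->; rewrite subee// fin_num_measure//; exact: measurableI.
apply: (measure_unique (@lower_boxes R n) (@cube R n)) => //.
- exact: lower_boxes_measurable.
- exact: lower_boxes_setI.
- by move=> k; exists [tuple k%:R | i < n].
- exact: cube_cover.
- move=> k; rewrite ltey_eq; apply/orP; left; apply: fin_num_measure.
  exact: measurable_lower_box.
Qed.

End moment_problem.

End unit_sphere_theory.

(** * Sets on which no harmonic polynomial vanishes *)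

Section uniqueness.
Context (R : realType) (n : nat).
Local Notation S := (@unit_sphere R n).
Local Open Scope complex_scope.

Definition power_moment (nu : {charge set (n.-tuple R) -> \bar R})
    (m : mpoly.multinom n) : R :=
  charge_integral nu S (fun y => \prod_(i < n) tnth y i ^+ m i).

Section harmonic_kernel.
Import -(notations) mpoly.
Import HarmonicAlgebra.
Variable nu : {charge set (n.-tuple R) -> \bar R}.

(** The sum of the squares of the coordinates is 1 on the sphere. *)
Lemma power_moment_trace m :
  \sum_(i < n) power_moment nu (mnm_add (mnm_add m (mnm1 i)) (mnm1 i)) =
  power_moment nu m.
Proof.
rewrite -charge_integral_sum; last 2 first.
- exact: measurable_unit_sphere.
- by move=> i; exact: bounded_measurable_monomial.
apply: eq_charge_integral => y Sy.
transitivity (dotv y y * \prod_(i < n) tnth y i ^+ m i); last first.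
  by rewrite -sqr_normv Sy expr1n mul1r.
rewrite mulr_suml; apply: eq_bigr => i _.
rewrite (bigD1 i)//= [in RHS](bigD1 i)//= !mnmDE !mnm1E eqxx !addn1 !exprSr.
rewrite [RHS]mulrA; congr (_ * _); first by ring.
by apply: eq_bigr => j ji; rewrite !mnmDE !mnm1E eq_sym (negbTE ji) !addn0.
Qed.

Let M m : R[i] := (power_moment nu m)%:C.

(** The right-hand side is, up to a power of the imaginary unit, the [k]-th
    Taylor coefficient of the Fourier transform on the line through [xi]. *)
Lemma meval_divpow_moment xi k :
  meval (fun i => (tnth xi i)%:C) (divpow k M) =
  (charge_integral nu S (fun y => dotv xi y ^+ k) / k`!%:R)%:C.
Proof.
have mS := @measurable_unit_sphere R n.
have -> : charge_integral nu S (fun y => dotv xi y ^+ k) / k`!%:R =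
    \sum_(m : bmultinom n k.+1) divpow_coef k (power_moment nu) m *
      \prod_(i < n) tnth xi i ^+ m i.
  rewrite mulrC -charge_integralZ//; last exact/bounded_measurableX/bounded_measurable_dotv.
  transitivity (charge_integral nu S (fun y => \sum_(m : bmultinom n k.+1)
      ((mdeg m == k)%:R * (mfact m)%:R^-1 * \prod_(i < n) tnth xi i ^+ m i) *
      \prod_(i < n) tnth y i ^+ m i)).
    apply: eq_charge_integral => y _.
    rewrite mulrC -[LHS](meval_divpow_exp (tnth xi) (tnth y)) meval_divpow.
    apply: eq_bigr => m _; rewrite /divpow_coef.
    by case: eqP => _ /=; rewrite ?mul0r//; ring.
  rewrite charge_integral_sum//; last first.
    move=> m; apply: bounded_measurableM; first exact: bounded_measurable_cst.
    exact: bounded_measurable_monomial.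
  apply: eq_bigr => m _; rewrite charge_integralZ//; last exact: bounded_measurable_monomial.
  by rewrite -/(power_moment nu m) /divpow_coef; case: eqP => _ /=; rewrite ?mul0r//; ring.
rewrite meval_divpow rmorph_sum; apply: eq_bigr => m _.
rewrite rmorphM rmorph_prod /=; congr (_ * _); last first.
  by apply: eq_bigr => i _; rewrite rmorphXn.
by rewrite /divpow_coef; case: eqP; rewrite ?rmorph0// fmorph_div rmorph_nat.
Qed.

(** If [nu] had a nonzero moment, the first nonzero polynomial [divpow k M]
    would be harmonic, and it vanishes on [C]. *)
Lemma charge_eq0_of_no_harmonic_zero (C : set (n.-tuple R)) :
  (forall l P, @harmonic_homog R n l P -> P != 0 -> ~ (C `<=` real_zeros P)) ->
  (forall xi k, C xi -> charge_integral nu S (fun y => dotv xi y ^+ k) = 0) ->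
  forall A, measurable A -> nu (A `&` S) = 0%E.
Proof.
move=> noP nu0 A mA; apply: charge_moments_eq0 => // k.
have M0 : forall m, M m = 0.
  apply: contrapT => /existsNP[m /eqP Mm].
  have [||l [Pl0 lapP]] := @divpow_first_harmonic _ n M.
  - move=> m'; rewrite -[RHS](congr1 (real_complex R) (power_moment_trace m')).
    by rewrite rmorph_sum.
  - apply: contrapT => /forallNP H; move/eqP: Mm; apply.
    by apply: divpow_eq0 => l; apply/eqP/negPn/negP; exact: H.
  apply: (noP l _ _ Pl0); first by split => //; exact: divpow_homog.
  by move=> xi Cxi; rewrite /real_zeros/= meval_divpow_moment nu0// mul0r.
have /(congr1 (@complex.Re R)) /= Mk := M0 (Multinom [tuple k i | i < n]).
rewrite -[RHS]Mk; apply: eq_charge_integral => y _.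
by apply: eq_bigr => i _; rewrite mnmE.
Qed.

End harmonic_kernel.

(** The values at [t] and [- t] separate the even part of the transform, which
    carries the cosines, from the odd part, which carries the sines; the real
    and imaginary parts of these then belong to different charges. *)
Lemma fourier_cos_sin (mu : complex_measure (n.-tuple R) R) xi :
  (forall t : R, fourier mu (scalev t xi) = 0) ->
  forall nu, nu = re_measure mu \/ nu = im_measure mu ->
  (forall t, charge_integral nu S (fun y => cos (t * dotv xi y)) = 0) /\
  (forall t, charge_integral nu S (fun y => sin (t * dotv xi y)) = 0).
Proof.
move=> F0 nu nuE.
pose c nu t := charge_integral nu S (fun y => cos (t * dotv xi y)).
pose s nu t := charge_integral nu S (fun y => sin (t * dotv xi y)).
have dotZ t y : dotv (scalev t xi) y = t * dotv xi y.
  by rewrite /dotv mulr_sumr; apply: eq_bigr => i _; rewrite tnth_mktuple mulrA.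
have mS := @measurable_unit_sphere R n.
have bsin t : bounded_measurable S (fun y => sin (t * dotv xi y)).
  split; last by exists 1 => x _; rewrite ler_norml sin_geN1 sin_le1.
  apply: (@measurableT_comp _ _ _ _ _ _ (@sin R)).
    by apply: continuous_measurable_fun; exact: continuous_sin.
  apply: measurable_funM; first exact: measurable_cst.
  by case: (bounded_measurable_dotv xi).
have cE nu' t : charge_integral nu' S
    (fun y => complex.Re (expi (- dotv (scalev t xi) y))) = c nu' t.
  by apply: eq_charge_integral => y _; rewrite /= dotZ cosN.
have sE nu' t : charge_integral nu' S
    (fun y => complex.Im (expi (- dotv (scalev t xi) y))) = - s nu' t.
  rewrite -[RHS]mulN1r /s -charge_integralZ//; apply: eq_charge_integral => y _.
  by rewrite /= dotZ sinN mulN1r.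
have cN nu' t : c nu' (- t) = c nu' t.
  by apply: eq_charge_integral => y _; rewrite mulNr cosN.
have sN nu' t : s nu' (- t) = - s nu' t.
  rewrite -[RHS]mulN1r /s -charge_integralZ//; apply: eq_charge_integral => y _.
  by rewrite mulNr sinN mulN1r.
have FE t : c (re_measure mu) t + s (im_measure mu) t = 0 /\
            c (im_measure mu) t - s (re_measure mu) t = 0.
  have /eqP := F0 t; rewrite /fourier /complex_integral !cE !sE eq_complex /=.
  by move=> /andP[/eqP + /eqP]; rewrite opprK addrC => -> <-; rewrite addrC.
split=> t; have := FE t; have := FE (- t); rewrite !cN !sN;
  rewrite -/(c nu t) -/(s nu t); case: nuE => -> [? ?] [? ?]; lra.
Qed.

Theorem heisenberg_of_no_harmonic_zero (C : set (n.-tuple R)) : is_cone C ->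
  (forall l P, @harmonic_homog R n l P -> P != 0 -> ~ (C `<=` real_zeros P)) ->
  sphere_heisenberg_pair C.
Proof.
move=> hC noP mu muS _ F0.
have nu0 nu : nu = re_measure mu \/ nu = im_measure mu ->
    forall A, measurable A -> nu (A `&` S) = 0%E.
  move=> nuE; apply: charge_eq0_of_no_harmonic_zero noP _ => xi k Cxi.
  have H t : fourier mu (scalev t xi) = 0 by apply: F0; apply: hC; exists xi.
  have [Hc Hs] := fourier_cos_sin H nuE.
  apply: charge_integral_moments => //.
  - exact: measurable_unit_sphere.
  - exact: bounded_measurable_dotv.
move=> A mA; have mS := @measurable_unit_sphere R n.
have muD : mu (A `\` S) = 0.
  by apply: muS; [exact: measurableD|rewrite setDE -setIA setICl setI0].
move: muD => [re0 im0].
have nuA nu : nu = re_measure mu \/ nu = im_measure mu ->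
    fine (nu (A `\` S)) = 0 -> fine (nu A) = 0.
  move=> nuE nuD; rewrite (chargeDI nu mA mS) nu0// adde0.
  exact: nuD.
by rewrite /complex_measure_fun !nuA//; [right|left].
Qed.

End uniqueness.

(** * Gaussian moments on the line *)

Section gaussian_moments.
Context (R : realType).
Local Notation mu := (@lebesgue_measure R).
Implicit Types (x : R) (k : nat).

Definition gauss_moment k : R := \int[mu]_x (x ^+ k * gauss_fun x).

(** Up to a factor the density of the standard normal law. It is used as a
    dominating function for polynomials times the faster decaying exp(-x^2). *)
Definition half_gauss x : R := expR (- (x ^+ 2 / 2)).

Lemma integrable_half_gauss : mu.-integrable setT (EFin \o half_gauss).
Proof.
have := @integrable_normal_pdf R 0 1; rewrite normal_pdfE ?oner_neq0// => H.
have p0 : normal_peak (1 : R) != 0 by rewrite gt_eqF// normal_peak_gt0// oner_neq0.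
have := @integrableZl _ _ _ mu setT measurableT (normal_peak 1)^-1 _ H.
apply: eq_integrable => // x _ /=.
rewrite -EFinM mulrA mulVf// mul1r /normal_fun /half_gauss subr0 expr1n mulNr.
by [].
Qed.

Definition gauss_bound k : R := 1 + 2 ^+ k * k`!%:R.

(** With y = x^2 / 2 the weight is exp(-y) times [half_gauss], and
    |x|^k <= 1 + (2 y)^k together with y^k <= k! exp(y) leaves a constant. *)
Lemma gauss_dominated k x :
  `|x ^+ k * gauss_fun x| <= gauss_bound k * half_gauss x.
Proof.
pose y := x ^+ 2 / 2.
have y0 : 0 <= y by rewrite divr_ge0// sqr_ge0.
have yk : y ^+ k <= k`!%:R * expR y.
  case: k => [|k]; first by rewrite expr0 mul1r -expR0 ler_expR.
  rewrite -ler_pdivrMl ?ltr0n ?fact_gt0// mulrC.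
  by rewrite (le_trans _ (expR_ge1Dxn k y0))// lerDr.
(* Small and large x apart: |x|^k is at most 1 or at most |x|^(2k). *)
have xk : `|x| ^+ k <= 1 + (x ^+ 2) ^+ k.
  have [x1|x1] := lerP `|x| 1.
    have xk1 : `|x| ^+ k <= 1 by exact: exprn_ile1.
    by rewrite (le_trans xk1)// lerDl exprn_ge0// sqr_ge0.
  rewrite -real_normK ?num_real// exprAC -[leLHS]add0r lerD//.
  by rewrite expr2 ler_peMr ?exprn_ge0// exprn_ege1// ltW.
rewrite normrM normrX (ger0_norm (gauss_fun_ge0 x)).
have -> : gauss_fun x = expR (- y) * half_gauss x.
  by rewrite /gauss_fun /half_gauss -expRD /y; congr expR; field.
rewrite mulrA ler_wpM2r ?expR_ge0// expRN ler_pdivrMr ?expR_gt0//.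
rewrite (le_trans xk)// /gauss_bound mulrDl mul1r lerD//.
  by rewrite -expR0 ler_expR.
have -> : x ^+ 2 = 2 * y by rewrite /y; field.
by rewrite exprMn -mulrA ler_wpM2l// exprn_ge0.
Qed.

Let continuous_gaussX k : continuous (fun x => x ^+ k * gauss_fun x).
Proof.
move=> x; apply: cvgM; last exact: continuous_gauss_fun.
exact: exprn_continuous.
Qed.

Lemma integrable_gaussX k :
  mu.-integrable setT (EFin \o (fun x => x ^+ k * gauss_fun x)).
Proof.
apply: (le_integrable measurableT _ _
    (@integrableZl _ _ _ mu setT measurableT (gauss_bound k) _ integrable_half_gauss)).
  apply/measurable_EFinP; apply: continuous_measurable_fun.
  exact: continuous_gaussX.
by move=> x _; rewrite /= lee_fin (le_trans (gauss_dominated k x))// ler_norm.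
Qed.

Let dgauss k x : R := (k%:R * x ^+ k.-1 - 2 * x ^+ k.+1) * gauss_fun x.

Let is_derive_gaussX k x :
  is_derive x (1:R) (fun x => x ^+ k * gauss_fun x) (dgauss k x).
Proof.
have Hn m : is_derive x (1:R) (fun x : R => x ^+ m) (m%:R * x ^+ m.-1).
  apply: DeriveDef; first exact: exprn_derivable.
  by rewrite exp_derive /GRing.scale/= mulr1.
have Hg : is_derive x (1:R) (@gauss_fun R) (- 2 * x * gauss_fun x).
  have H : is_derive x (1:R) (fun x : R => - x ^+ 2) (- (2 * x)).
    exact: is_deriveN (Hn 2).
  have := @is_derive1_comp _ expR (fun x : R => - x ^+ 2) x _ _
    (is_derive_expR (- x ^+ 2)) H.
  rewrite (_ : _ * - _ = - 2 * x * gauss_fun x); first exact.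
  by rewrite /gauss_fun; ring.
have := is_deriveM (Hn k) Hg; rewrite /GRing.scale/=.
rewrite (_ : _ + _ = dgauss k x); first exact.
by rewrite /dgauss exprS; ring.
Qed.

Let dgaussE k : dgauss k = (fun x => k%:R * (x ^+ k.-1 * gauss_fun x) +
                                - 2 * (x ^+ k.+1 * gauss_fun x)).
Proof. by apply/funext => x; rewrite /dgauss; ring. Qed.

Let integrable_dgauss k : mu.-integrable setT (EFin \o dgauss k).
Proof.
rewrite dgaussE; apply: (@integrableD _ _ _ mu setT measurableT
  (fun x => (k%:R * (x ^+ k.-1 * gauss_fun x))%:E)
  (fun x => (- 2 * (x ^+ k.+1 * gauss_fun x))%:E)).
- exact: (@integrableZl _ _ _ mu setT measurableT k%:R _ (integrable_gaussX k.-1)).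
- exact: (@integrableZl _ _ _ mu setT measurableT (- 2) _ (integrable_gaussX k.+1)).
Qed.

Let integral_dgauss_itv k N : 0 < N ->
  \int[mu]_(x in `[- N, N]) dgauss k x =
  N ^+ k * gauss_fun N - (- N) ^+ k * gauss_fun (- N).
Proof.
move=> N0.
have NN : - N < N by rewrite gt0_cp.
have C : continuous (dgauss k).
  rewrite dgaussE => x; apply: cvgD; apply: cvgM; try exact: cvg_cst.
    exact: continuous_gaussX.
  exact: continuous_gaussX.
have CF := @continuous_gaussX k.
rewrite /Rintegral (@continuous_FTC2 _ (dgauss k) (fun x => x ^+ k * gauss_fun x))//.
- exact: continuous_subspaceT.
- split.
  + by move=> x _; case: (is_derive_gaussX k x).
  + exact: (cvg_at_right_filter (CF _)).
  + exact: (cvg_at_left_filter (CF _)).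
- by move=> x _; rewrite derive1E; case: (is_derive_gaussX k x).
Qed.

Let boundary_term_cvg k :
  (m.+1%:R : R) ^+ k * gauss_fun m.+1%:R - (- m.+1%:R) ^+ k * gauss_fun (- m.+1%:R)
    @[m --> \oo] --> 0.
Proof.
(* A crude bound suffices, as long as it tends to 0 at infinity. *)
have B x : 0 < x -> half_gauss x <= x^-1.
  move=> x0; rewrite /half_gauss expRN lef_pV2 ?posrE ?expR_gt0//.
  rewrite (le_trans _ (expR_ge1Dx _))//.
  have := sqr_ge0 (x - 1); nra.
have B' x m : `|x| = m.+1%:R -> `|x ^+ k * gauss_fun x| <= gauss_bound k * harmonic m.
  move=> xm; rewrite (le_trans (gauss_dominated k x))// ler_wpM2l//.
    by rewrite addr_ge0// mulr_ge0// exprn_ge0.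
  by rewrite /half_gauss -real_normK ?num_real// xm; exact: B.
have C (f : R^nat) : (forall m, `|f m| = m.+1%:R) ->
    f m ^+ k * gauss_fun (f m) @[m --> \oo] --> 0.
  move=> fm; apply: norm_cvg0.
  apply: (@squeeze_cvgr _ _ _ _ (cst 0) (fun m => gauss_bound k * harmonic m)).
  - by apply: nearW => m; rewrite normr_ge0 B'.
  - exact: cvg_cst.
  - rewrite -[X in _ --> X](mulr0 (gauss_bound k)); apply: cvgM; first exact: cvg_cst.
    exact: cvg_harmonic.
rewrite -[X in _ --> X](subrr 0); apply: cvgB.
  by apply: C => m; rewrite normr_nat.
by apply: (C (fun m => - m.+1%:R)) => m; rewrite normrN normr_nat.
Qed.

Let integral_dgauss k : \int[mu]_x dgauss k x = 0.
Proof.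
pose I m := `[- m.+1%:R, (m.+1%:R : R)]%classic.
have mI m : measurable (I m) by exact: measurable_itv.
have idg := integrable_dgauss k.
have [_ mdg] := integrableP _ _ _ idg.
have [||||_ _ H] := @dominated_convergence _ _ _ mu setT measurableT
    (fun m => EFin \o (dgauss k \_ (I m))) (EFin \o dgauss k)
    (abse \o (EFin \o dgauss k)) _ _ _ (integrable_abse idg) _.
  - move=> m; apply/measurable_EFinP/(measurable_restrictT _ (mI m)).
    by apply/measurable_EFinP/measurable_funTS; exact: measurable_int idg.
  - exact: measurable_int idg.
  - apply: aeW => x _; apply: cvg_near_cst.
    near=> m; rewrite /= patchE mem_set// /I /= in_itv/= -ler_norml.
    rewrite (le_trans (ltW (truncnS_gt _)))// ler_nat.
    by near: m; exact: nbhs_infty_ge.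
  - apply: aeW => x m _ /=; rewrite patchE; case: ifP => // _.
    by rewrite /point /= normr0 lee_fin.
have {}H : \int[mu]_(x in I m) dgauss k x @[m --> \oo] --> \int[mu]_x dgauss k x.
  under eq_cvg do rewrite Rintegral_mkcond.
  apply: fine_cvg; rewrite fineK; first exact: H.
  exact: integrable_fin_num.
rewrite -(cvg_lim _ H)//; apply/cvg_lim => //.
under eq_cvg do rewrite integral_dgauss_itv//.
exact: boundary_term_cvg.
Unshelve. all: by end_near. Qed.

(** The integral over the line of the derivative of x^k exp(-x^2) is zero. *)
Lemma gauss_moment_rec k : k%:R * gauss_moment k.-1 = 2 * gauss_moment k.+1.
Proof.
apply/eqP; rewrite -subr_eq0; apply/eqP.
rewrite -[RHS](integral_dgauss k) /gauss_moment.
rewrite -!RintegralZl// ?integrable_gaussX// -RintegralB//.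
- by apply: eq_Rintegral => x _; rewrite /dgauss; ring.
- apply: (@integrableZl _ _ _ mu setT measurableT k%:R _ (integrable_gaussX k.-1)).
- apply: (@integrableZl _ _ _ mu setT measurableT 2 _ (integrable_gaussX k.+1)).
Qed.

Lemma gauss_moment1 : gauss_moment 1 = 0.
Proof.
have := gauss_moment_rec 0; rewrite mul0r => /esym/eqP.
by rewrite mulf_eq0 pnatr_eq0/= => /eqP.
Qed.

Lemma gauss_momentS k : gauss_moment k.+2 = k.+1%:R / 2 * gauss_moment k.
Proof.
have := gauss_moment_rec k.+1 => /=; rewrite mulrAC => ->.
by rewrite mulrC mulKf// pnatr_eq0.
Qed.

Lemma gauss_moment0_neq0 : gauss_moment 0 != 0.
Proof.
rewrite /gauss_moment /Rintegral.
under eq_integral do rewrite expr0 mul1r.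
rewrite integralT_gauss/= gt_eqF// sqrtr_gt0 pi_gt0//.
Qed.

End gaussian_moments.

(** * Lebesgue measure on tuples *)

Section lebesgue_tuple_theory.
Context (R : realType).
Local Notation mu := (@lebesgue_measure R).
Local Notation lam n := (lebesgue_tuple R n).

(** Fubini's theorem for product functions. Indexing the factors by [nat] lets
    the induction on [n] shift them. *)
Lemma integral_prod_coord n (f : nat -> R -> R) :
  (forall i, mu.-integrable setT (EFin \o f i)) ->
  (lam n).-integrable setT (EFin \o (fun x : n.-tuple R => \prod_(i < n) f i (tnth x i))) /\
  \int[lam n]_x \prod_(i < n) f i (tnth x i) = \prod_(i < n) \int[mu]_t f i t.
Proof.
elim: n f => [|n IH] f fi.
  have E : (fun x : 0.-tuple R => \prod_(i < 0) f i (tnth x i)) = cst 1.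
    by apply/funext => x; rewrite big_ord0.
  have lam1 : lam 0 setT = 1%E by exact: diracT.
  rewrite E big_ord0; split; last by rewrite Rintegral_cst// mul1r [X in fine X]lam1.
  apply: measurable_bounded_integrable => //; first by rewrite [X in (X < _)%E]lam1 ltry.
  exact: bounded_cst.
have [Fi FE] := IH (fun i => f i.+1) (fun i => fi i.+1).
set F := (fun x : n.-tuple R => _) in Fi FE.
have mF : measurable_fun setT F by apply/measurable_EFinP; exact: measurable_int Fi.
have mf i : measurable_fun setT (f i) by apply/measurable_EFinP; exact: measurable_int (fi i).
pose G := (fun x : n.+1.-tuple R => \prod_(i < n.+1) f i (tnth x i)).
have GE (p : measurableTypeR R * n.-tuple R) : G (consv p) = f 0 p.1 * F p.2.
  rewrite /G big_ord_recl; congr (_ * _).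
  by apply: eq_bigr => i _; rewrite (tnth_nth 0) [in RHS](tnth_nth 0).
have mG : measurable_fun setT G.
  apply: (@measurable_prod _ _ R setT 'I_n.+1 (index_enum _)
    (fun i x => f i (tnth x i))) => i _.
  exact: measurableT_comp (measurable_tnth i).
have mfF : measurable_fun setT (fun p : measurableTypeR R * n.-tuple R => f 0 p.1 * F p.2).
  apply: measurable_funM; first exact: measurableT_comp (mf 0) measurable_fst.
  exact: measurableT_comp mF measurable_snd.
have ifF : (mu \x lam n)%E.-integrable setT
    (EFin \o (fun p : measurableTypeR R * n.-tuple R => f 0 p.1 * F p.2)).
  apply/integrable12ltyP; first exact/measurable_EFinP.
  have [_ fi0] := integrableP _ _ _ (fi 0).
  have [_ Fi0] := integrableP _ _ _ Fi.
  have mF' : measurable_fun setT (fun y => `|(F y)%:E|%E).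
    by apply: measurableT_comp => //; exact/measurable_EFinP.
  under eq_integral => x _.
    under eq_integral => y _ do rewrite /= normrM EFinM.
    rewrite ge0_integralZl//.
    over.
  rewrite /=.
  rewrite ge0_integralZr//.
  - apply: lte_mul_pinfty; last exact: Fi0.
    + exact: integral_ge0.
    + rewrite ge0_fin_numE; last exact: integral_ge0. exact: fi0.
  - by apply/measurable_EFinP; exact: measurableT_comp (mf 0).
  - exact: integral_ge0.
have mcons := @measurable_consv R n.
have GcE : (EFin \o G) \o @consv R n =
    EFin \o (fun p : measurableTypeR R * n.-tuple R => f 0 p.1 * F p.2).
  by apply/funext => p /=; rewrite GE.
have mEG : measurable_fun setT (EFin \o G) by exact/measurable_EFinP.
split.
  apply: (integrable_pushforward mcons mEG) => //.
  by rewrite preimage_setT GcE.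
rewrite big_ord_recl -FE /Rintegral.
rewrite [X in fine X](integral_pushforward mcons mEG) ?preimage_setT ?GcE//.
rewrite -integral12_prod_meas1//= /fubini_F/=.
under eq_integral => x _.
  under eq_integral => y _ do rewrite /= EFinM.
  rewrite integralZl//.
  over.
rewrite /=.
have fF : (\int[lam n]_y (F y)%:E)%E \is a fin_num by exact: integrable_fin_num.
rewrite -(fineK fF) integralZr//=; last exact: fi.
by rewrite fineM// integrable_fin_num//; exact: fi.
Qed.

Let dilation (r : R) : measurableTypeR R -> measurableTypeR R := fun x => r * x.

Let measurable_dilation r : measurable_fun setT (dilation r).
Proof. by apply: measurable_funM; first exact: measurable_cst. Qed.

(** The measure [mu] is characterised by its values on half-open intervals, and
    [r] times the image measure takes the same ones. *)
Lemma lebesgue_measure_dilation (r : R) A : 0 < r -> measurable A ->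
  pushforward mu (dilation r) A = (r^-1%:E * mu A)%E.
Proof.
move=> r0 mA.
pose sM : {mfun (measurableTypeR R) >-> (measurableTypeR R)} :=
  HB.pack (dilation r) (isMeasurableFun.Build _ _ _ _ _ (measurable_dilation r)).
have H : forall B, measurable B ->
    mu B = mscale (NngNum (ltW r0)) (pushforward mu sM) B.
  move=> B mB; apply: lebesgue_measure_unique => // _ [[a b] _ <-].
  transitivity (r%:E * mu (dilation r @^-1` `]a, b]%classic))%E; last by [].
  rewrite (_ : _ @^-1` _ = `]a / r, b / r]%classic); last first.
    apply/seteqP; split=> x /=;
      by rewrite !in_itv/= ltr_pdivrMr// ler_pdivlMr// /dilation mulrC.
  rewrite /= !lebesgue_measure_itv/= !lte_fin ltr_pM2r ?invr_gt0//.
  case: ifPn => _; last by rewrite mule0.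
  by rewrite -!EFinB -EFinM mulrBr !(mulrC r) !divfK ?gt_eqF.
by rewrite H// /mscale muleA -EFinM mulVf ?gt_eqF// mul1e.
Qed.

Lemma ge0_integral_dilation (r : R) (f : R -> \bar R) : 0 < r ->
  measurable_fun setT f -> (forall x, 0 <= f x)%E ->
  (\int[mu]_x f (r * x)%R = r^-1%:E * \int[mu]_x f x)%E.
Proof.
move=> r0 mf f0.
have ri0 : 0 <= r^-1 by rewrite invr_ge0 ltW.
rewrite -(@ge0_integral_mscale _ _ _ mu setT measurableT (NngNum ri0))//.
rewrite -[LHS](@ge0_integral_pushforward _ _ _ _ _ _ (measurable_dilation r) mu setT f)//.
apply: eq_measure_integral => B mB _.
exact: (lebesgue_measure_dilation r0 mB).
Qed.

Lemma scalev_consv n (r : R) p :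
  scalev r (@consv R n p) = consv (r * p.1, scalev r p.2).
Proof.
apply: eq_from_tnth => i; rewrite tnth_mktuple.
have [->|[j ->]] : i = ord0 \/ exists j, i = lift ord0 j.
  by case: (unliftP ord0 i) => [j ->|->]; [right; exists j|left].
  by rewrite !tnth0.
by rewrite !tnthS tnth_mktuple.
Qed.

(** Slice along the first coordinate; every coordinate contributes a factor
    [r^-1]. This is the only geometric input to polar coordinates. *)
Lemma lebesgue_tuple_scale n (r : R) (A : set (n.-tuple R)) : 0 < r -> measurable A ->
  lam n (scalev r @^-1` A) = ((r^-1 ^+ n)%:E * lam n A)%E.
Proof.
move=> r0; elim: n A => [|n IH] A mA.
  rewrite expr0 mul1e; congr (lam 0 _).
  apply/seteqP; split=> x /=; rewrite (_ : scalev r x = x)//;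
    by apply: eq_from_tnth; case.
have mB : measurable (@consv R n @^-1` A).
  by rewrite -[X in measurable X]setTI; exact: measurable_consv.
transitivity (\int[mu]_x ((r^-1 ^+ n)%:E *
    lam n (xsection (@consv R n @^-1` A) (r * x)%R)))%E.
  rewrite /= /lebesgue_succ /pushforward/= /product_measure1.
  apply: eq_integral => x _ /=.
  rewrite -IH; last exact: measurable_xsection.
  congr (lam n _); apply/seteqP; split=> y /=; rewrite /xsection /= !inE /=;
    by rewrite scalev_consv.
rewrite (ge0_integral_dilation (f := fun x => ((r^-1 ^+ n)%:E *
    lam n (xsection (@consv R n @^-1` A) x))%E))//.
- rewrite ge0_integralZl//.
  + by rewrite muleA -EFinM -exprS.
  + exact: measurable_fun_xsection.
  + by rewrite lee_fin exprn_ge0// invr_ge0 ltW.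
- by apply: measurable_funeM; exact: measurable_fun_xsection.
- by move=> x; rewrite mule_ge0// lee_fin exprn_ge0// invr_ge0 ltW.
Qed.

End lebesgue_tuple_theory.

(** * Polar coordinates *)

Section polar_coordinates.
Context (R : realType) (n : nat).
Local Notation T := (n.-tuple R).
Local Notation lam := (lebesgue_tuple R n).
Implicit Types x : T.

Lemma scalevA (a b : R) x : scalev a (scalev b x) = scalev (a * b) x.
Proof. by apply: eq_from_tnth => i; rewrite !tnth_mktuple mulrA. Qed.

Lemma scale1v x : scalev 1 x = x.
Proof. by apply: eq_from_tnth => i; rewrite tnth_mktuple mul1r. Qed.

Lemma normv_ge0 x : 0 <= normv x. Proof. exact: sqrtr_ge0. Qed.

Lemma normv_scale (c : R) x : 0 <= c -> normv (scalev c x) = c * normv x.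
Proof.
move=> c0; rewrite /normv (_ : dotv _ _ = c ^+ 2 * dotv x x).
  by rewrite sqrtrM ?sqr_ge0// sqrtr_sqr ger0_norm.
by rewrite /dotv mulr_sumr; apply: eq_bigr => i _; rewrite !tnth_mktuple; ring.
Qed.

Lemma radial_proj_scale (c : R) x : 0 < c -> radial_proj (scalev c x) = radial_proj x.
Proof.
move=> c0; rewrite /radial_proj scalevA normv_scale ?ltW// invfM.
by rewrite mulrAC mulVf ?gt_eqF// mul1r.
Qed.

Lemma radial_proj_sphere x : 0 < normv x -> unit_sphere (radial_proj x).
Proof.
move=> x0; rewrite /unit_sphere/= /radial_proj normv_scale ?invr_ge0 ?normv_ge0//.
by rewrite mulVf// gt_eqF.
Qed.

Lemma scalev_radial_proj x : 0 < normv x -> scalev (normv x) (radial_proj x) = x.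
Proof. by move=> x0; rewrite /radial_proj scalevA mulfV ?gt_eqF// scale1v. Qed.

Lemma prod_gauss x : \prod_(i < n) gauss_fun (tnth x i) = gauss_fun (normv x).
Proof.
rewrite /gauss_fun sqr_normv /dotv -sumrN expR_sum.
by apply: eq_bigr => i _; rewrite expr2.
Qed.

Lemma prod_half_gauss x : \prod_(i < n) half_gauss (tnth x i) = half_gauss (normv x).
Proof.
rewrite /half_gauss sqr_normv /dotv mulr_suml -sumrN expR_sum.
by apply: eq_bigr => i _; rewrite expr2.
Qed.

Lemma integrable_half_gauss_normv :
  lam.-integrable setT (EFin \o (fun x => half_gauss (normv x))).
Proof.
have [H _] := @integral_prod_coord R n (fun=> @half_gauss R)
  (fun=> @integrable_half_gauss R).
by apply: eq_integrable H => // x _; rewrite /= prod_half_gauss.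
Qed.

(** The ball is contained in a cube, whose indicator is a product. *)
Lemma lebesgue_punctured_ball_lty : (lam (@punctured_ball R n) < +oo)%E.
Proof.
have mB := @measurable_punctured_ball R n.
have := @integral_prod_coord R n (fun=> \1_(`[-1, 1]%classic : set R)).
move=> /(_ (fun=> integrable_indic_itv _ _ _ _))[/integrableP[mF Foo] _].
apply: le_lt_trans Foo.
rewrite (_ : lam _ = \int[lam]_x (\1_(@punctured_ball R n) x)%:E)%E; last first.
  by rewrite integral_indic// setIT.
apply: ge0_le_integral => //.
- exact/measurable_EFinP/measurable_indic.
- exact: measurableT_comp.
- move=> x _; rewrite /= lee_fin indicE.
  have [/set_mem xB|_] := boolP (x \in @punctured_ball R n); last exact: normr_ge0.
  rewrite big1 ?normr1// => i _; rewrite indicE mem_set//= in_itv/= -ler_norml.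
  by rewrite (le_trans (coord_le_normv _ _))//; case/andP: xB.
Qed.

Hypothesis n0 : (0 < n)%N.

(** The indicator of the origin is bounded by a product of indicators of
    singletons of the line; there is at least one factor. *)
Lemma lebesgue_origin_eq0 : lam [set x | normv x = 0] = 0%E.
Proof.
have m0 : measurable [set x : T | normv x = 0].
  rewrite -[X in measurable X]setTI.
  exact: (@measurable_normv R n measurableT _ (measurable_set1 _)).
have i1 : lebesgue_measure.-integrable setT (EFin \o \1_([set 0] : set R)).
  by rewrite -set_itv1; exact: integrable_indic_itv.
have := @integral_prod_coord R n (fun=> \1_([set 0] : set R)).
move=> /(_ (fun=> i1))[/integrableP[mF Foo]].
rewrite [X in _ = X](_ : _ = 0) => [F0|]; last first.
  rewrite (bigD1 (Ordinal n0))//= (_ : \int[_]_t _ = 0) ?mul0r//.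
  rewrite /Rintegral integral_indic// setIT.
  by rewrite [X in fine X](lebesgue_measure_set1 0).
have F0' : (\int[lam]_x (\prod_(i < n) \1_[set 0] (tnth x i) : R)%:E = 0)%E.
  rewrite -[LHS]fineK ?[X in X%:E]F0//; apply: integrable_fin_num => //.
  by apply/integrableP; split.
apply/eqP; rewrite -measure_le0 -F0'.
apply: (@le_trans _ _ (\int[lam]_x (\1_[set x : T | normv x = 0] x)%:E)%E).
  by rewrite integral_indic// setIT.
apply: ge0_le_integral => //.
- exact/measurable_EFinP/measurable_indic.
- move=> x _; rewrite lee_fin indicE.
  have [/set_mem /= xB|_] := boolP (x \in _); last by rewrite prodr_ge0.
  rewrite big1// => i _; rewrite indicE mem_set//=.
  by apply/eqP; rewrite -normr_le0 -xB coord_le_normv.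
Qed.

End polar_coordinates.

Section closed_rays.
Context (R : realType).

(** Closed rays match the closed outer boundary of [punctured_ball]: the part of
    a cone on which the norm is at most [r] is a dilate of its trace on the ball. *)
Definition closed_rays : set (set (measurableTypeR R)) := range (fun r => `]-oo, r]%classic).

Lemma closed_rays_measurable : measurable = <<s closed_rays >>.
Proof.
apply/seteqP; split; last first.
  apply: smallest_sub; first exact: sigma_algebra_measurable.
  by move=> _ [r _ <-]; exact: measurable_itv.
rewrite [X in X `<=` _](RGenInftyO.measurableE R).
apply: smallest_sub; first exact: smallest_sigma_algebra.
move=> _ [x ->].
rewrite (_ : `]-oo, x[%classic = \bigcup_k `]-oo, x - k.+1%:R^-1]%classic).
  apply: (@bigcupT_measurable _ (g_sigma_algebraType closed_rays)) => k.
  by apply: sub_sigma_algebra; exists (x - k.+1%:R^-1).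
apply/seteqP; split=> y /=.
  rewrite in_itv/= => yx; exists (Num.truncn (x - y)^-1) => //=.
  rewrite in_itv/= lerBrDr -lerBrDl invf_ple ?posrE ?subr_gt0//.
  by apply/ltW; exact: truncnS_gt.
by move=> [k _]; rewrite /= !in_itv/= => /le_lt_trans; apply; rewrite ltrBlDr ltrDl.
Qed.

Lemma closed_rays_setI : setI_closed closed_rays.
Proof.
move=> _ _ [a _ <-] [b _ <-]; exists (Num.min a b) => //.
by apply/seteqP; split=> x /=; rewrite !in_itv/= le_min => /andP.
Qed.

Lemma closed_rays_cover : \bigcup_(k : nat) `]-oo, (k%:R : R)]%classic = setT.
Proof.
apply/seteqP; split=> // x _; exists (Num.truncn x).+1 => //=.
by rewrite in_itv/= ltW// truncnS_gt.
Qed.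

End closed_rays.

Section image_measure.
Context d d' (T1 : measurableType d) (T2 : measurableType d') (R : realType).
Variables (m : {measure set T1 -> \bar R}) (f : T1 -> T2).
Hypothesis mf : measurable_fun setT f.

(** The pushforward as a bundled measure, with the measurability of the map
    supplied once. *)
Definition image_measure : {measure set T2 -> \bar R}.
Proof. by unshelve refine (pushforward m f : {measure set T2 -> \bar R}). Defined.

Lemma ge0_integral_image (g : T2 -> \bar R) : measurable_fun setT g ->
  (forall y, 0 <= g y)%E -> (\int[image_measure]_y g y = \int[m]_x g (f x))%E.
Proof. by move=> mg g0; rewrite ge0_integral_pushforward. Qed.

End image_measure.

Section polar_measures.
Context (R : realType) (n : nat).
Local Notation T := (n.-tuple R).
Local Notation lam := (lebesgue_tuple R n).
Implicit Types x : T.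

(** The norm with values in the Borel space of the line. *)
Definition radius : T -> measurableTypeR R := @normv R n.

Lemma measurable_radius : measurable_fun setT radius.
Proof. exact: measurable_normv. Qed.

Definition punctured_space : set T := [set x | 0 < normv x].

Definition punctured_cone (A : set T) : set T :=
  punctured_space `&` @radial_proj R n @^-1` A.

Lemma measurable_punctured_space : measurable punctured_space.
Proof.
rewrite (_ : punctured_space = radius @^-1` `]0, +oo[%classic); last first.
  by apply/seteqP; split=> x /=; rewrite in_itv/= andbT.
by rewrite -[X in measurable X]setTI; exact: measurable_radius.
Qed.

Lemma measurable_punctured_cone A : measurable A -> measurable (punctured_cone A).
Proof.
move=> mA; apply: measurableI; first exact: measurable_punctured_space.
by rewrite -[X in measurable X]setTI; exact: measurable_radial_proj.
Qed.

(** The region whose volume defines [surface_measure]. *)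
Definition unit_cone (A : set T) : set T :=
  @radial_proj R n @^-1` A `&` @punctured_ball R n.

Lemma measurable_unit_cone A : measurable A -> measurable (unit_cone A).
Proof.
move=> mA; apply: measurableI; last exact: measurable_punctured_ball.
by rewrite -[X in measurable X]setTI; exact: measurable_radial_proj.
Qed.

Lemma unit_cone_fin A : measurable A -> lam (unit_cone A) \is a fin_num.
Proof.
move=> mA; rewrite ge0_fin_numE//; apply: le_lt_trans (lebesgue_punctured_ball_lty R n).
apply: le_measure; rewrite ?inE; [exact: measurable_unit_cone|exact: measurable_punctured_ball|].
exact: subIsetr.
Qed.

(** For r > 0 the set on the left is the dilate of [unit_cone A] of ratio [r]. *)
Lemma lebesgue_cone_ray A (r : R) : measurable A ->
  lam (radius @^-1` `]-oo, r] `&` punctured_cone A) =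
  ((if 0 < r then r ^+ n else 0)%:E * lam (unit_cone A))%E.
Proof.
move=> mA; case: ifPn => [r0|]; last first.
  rewrite -leNgt mul0e => r0; rewrite (_ : _ `&` _ = set0) ?measure0//.
  apply/seteqP; split=> x //= [+ [/= x0 _]]; rewrite in_itv/= => xr.
  by have := lt_le_trans x0 (le_trans xr r0); rewrite ltxx.
rewrite -[X in (X ^+ n)%:E]invrK -lebesgue_tuple_scale ?invr_gt0//; last first.
  exact: measurable_unit_cone.
congr (lam _); apply/seteqP; split=> x /=.
  rewrite in_itv/= => -[xr [/= x0 xA]]; split=> /=.
    by rewrite radial_proj_scale// invr_gt0.
  rewrite /punctured_ball/= normv_scale ?invr_ge0 ?(ltW r0)//.
  by rewrite mulr_gt0 ?invr_gt0//= mulrC ler_pdivrMr// mul1r.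
rewrite /unit_cone/= radial_proj_scale ?invr_gt0// /punctured_ball/=.
rewrite normv_scale ?invr_ge0 ?(ltW r0)// pmulr_rgt0 ?invr_gt0// mulrC.
by rewrite ler_pdivrMr// mul1r in_itv/= => -[xA /andP[x0 xr]].
Qed.

(** The image of Lebesgue measure under the norm, that is a multiple of
    r^(n-1) dr on the positive half-line. *)
Definition radial_measure (I : set (measurableTypeR R)) : \bar R :=
  lam (radius @^-1` I `&` punctured_space).

Let radial_image := image_measure (mrestr lam measurable_punctured_space)
  measurable_radius.

Let radial_measure0 : radial_measure set0 = 0%E.
Proof. exact: (measure0 radial_image). Qed.

Let radial_measure_ge0 I : (0 <= radial_measure I)%E.
Proof. exact: (measure_ge0 radial_image). Qed.

Let radial_measure_sigma_additive : semi_sigma_additive radial_measure.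
Proof. exact: (@measure_semi_sigma_additive _ _ _ radial_image). Qed.

HB.instance Definition _ := isMeasure.Build _ _ _ radial_measure
  radial_measure0 radial_measure_ge0 radial_measure_sigma_additive.

Lemma radial_measureE I :
  radial_measure I = lam (radius @^-1` I `&` punctured_cone setT).
Proof. by rewrite /radial_measure /punctured_cone preimage_setT setIT. Qed.

Let radial_measure_sigma_finite : sigma_finite setT radial_measure.
Proof.
exists (fun k => `]-oo, (k%:R : R)]%classic); first by rewrite closed_rays_cover.
move=> k; split; first exact: measurable_itv.
rewrite radial_measureE lebesgue_cone_ray//.
rewrite ltey_eq; apply/orP; left; rewrite fin_numM// unit_cone_fin//.
Qed.

HB.instance Definition _ := Measure_isSigmaFinite.Build _ _ _ radial_measure
  radial_measure_sigma_finite.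

Lemma surface_measureE A : surface_measure A = (n%:R%:E * lam (unit_cone A))%E.
Proof. by []. Qed.

Let surface_measure_fin : fin_num_fun (@surface_measure R n).
Proof. by move=> A mA; rewrite surface_measureE fin_numM// unit_cone_fin. Qed.

HB.instance Definition _ := @Measure_isFinite.Build _ _ _ (@surface_measure R n)
  surface_measure_fin.

(** In polar coordinates Lebesgue measure is proportional to the product of
    [radial_measure] and [surface_measure]. For fixed [A] both sides are measures
    in [I], and on closed rays they agree by [lebesgue_cone_ray]. *)
Lemma lebesgue_cone_shell (I : set (measurableTypeR R)) (A : set T) : measurable I -> measurable A ->
  (@surface_measure R n setT * lam (radius @^-1` I `&` punctured_cone A) =
   radial_measure I * surface_measure A)%E.
Proof.
move=> mI mA.
have mK := measurable_punctured_cone mA.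
have s0 B : 0 <= fine (@surface_measure R n B) by exact: fine_ge0.
pose m1 := mscale (NngNum (s0 setT)) (image_measure (mrestr lam mK) measurable_radius).
pose m2 := mscale (NngNum (s0 A)) radial_measure.
have m1E B : m1 B = ((fine (@surface_measure R n setT))%:E *
    lam (radius @^-1` B `&` punctured_cone A))%E by [].
have m2E B : m2 B = ((fine (@surface_measure R n A))%:E * radial_measure B)%E by [].
have fE B : measurable B -> (fine (@surface_measure R n B))%:E = surface_measure B.
  by move=> mB; rewrite fineK// surface_measure_fin.
suff : m1 I = m2 I by rewrite [LHS]m1E [X in _ = X -> _]m2E !fE// => ->; rewrite muleC.
apply: (@measure_unique _ R (measurableTypeR R) (@closed_rays R)
  (fun k => `]-oo, (k%:R : R)]%classic) _ _ _ _ m1 m2 _ _ I mI).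
- exact: closed_rays_measurable.
- exact: closed_rays_setI.
- by move=> k; exists k%:R.
- exact: closed_rays_cover.
- move=> _ [r _ <-]; rewrite [LHS]m1E [RHS]m2E !fE// radial_measureE.
  rewrite !lebesgue_cone_ray// !surface_measureE.
  rewrite -(fineK (unit_cone_fin mA)) -(fineK (unit_cone_fin measurableT)).
  by rewrite -!EFinM; congr (_%:E); ring.
- move=> k; rewrite [X in (X < _)%E]m1E lebesgue_cone_ray//.
  by rewrite ltey_eq; apply/orP; left; rewrite !fin_numM// unit_cone_fin.
Qed.

End polar_measures.

Section polar_integration.
Context (R : realType) (n : nat).
Local Notation T := (n.-tuple R).
Local Notation lam := (lebesgue_tuple R n).
Local Notation sigma := (@surface_measure R n).
Local Notation pos := (@punctured_space R n).

Definition polar_map (x : T) : measurableTypeR R * T := (radius x, radial_proj x).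

Lemma measurable_polar_map : measurable_fun setT polar_map.
Proof.
apply: measurable_fun_pair; first exact: measurable_radius.
exact: measurable_radial_proj.
Qed.

Lemma ge0_integral_mrestr d (X : measurableType d) (m : {measure set X -> \bar R})
    (D : set X) (mD : measurable D) (f : X -> \bar R) :
  measurable_fun setT f -> (forall x, 0 <= f x)%E ->
  (\int[mrestr m mD]_x f x = \int[m]_(x in D) f x)%E.
Proof.
move=> mf f0; rewrite (@ge0_negligible_integral _ _ _ _ setT (~` D))//.
- rewrite setTD setCK; apply: eq_measure_integral => A mA AD.
  by rewrite /mrestr; congr (m _); exact/setIidPl.
- exact: measurableC.
- by rewrite [LHS](_ : _ = m (~` D `&` D))// setICl measure0.
Qed.

(** By [lebesgue_cone_shell] the image of Lebesgue measure under [polar_map] is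
    proportional to a product measure; Tonelli's theorem splits the integral. *)
Lemma ge0_integral_polar (g : R -> R) (F : T -> R) :
  measurable_fun setT g -> measurable_fun setT F ->
  (forall r, 0 <= g r) -> (forall x, 0 <= F x) ->
  (sigma setT * \int[lam]_(x in pos) (F (radial_proj x) * g (normv x))%:E =
   (\int[@radial_measure R n]_r (g r)%:E) * \int[sigma]_y (F y)%:E)%E.
Proof.
move=> mg mF g0 F0.
have s0 : 0 <= fine (sigma setT) by exact: fine_ge0.
pose m := image_measure (mrestr lam (@measurable_punctured_space R n)) measurable_polar_map.
pose m' := mscale (NngNum s0) m.
have sE : (fine (sigma setT))%:E = sigma setT by rewrite fineK// fin_num_measure.
have mE X : measurable X -> (@radial_measure R n \x sigma)%E X = m' X.
  apply: (@product_measure_unique _ _ _ _ _ (@radial_measure R n) sigma m').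
  move=> I A mI mA; transitivity ((fine (sigma setT))%:E *
    lam (polar_map @^-1` (I `*` A) `&` pos))%E => //.
  rewrite sE -lebesgue_cone_shell//; congr (_ * lam _)%E.
  by apply/seteqP; split=> x; [move=> [[xI xA] x0]|move=> [xI [x0 xA]]].
pose h (p : measurableTypeR R * T) := F p.2 * g p.1.
have mh : measurable_fun setT (EFin \o h).
  apply/measurable_EFinP; apply: measurable_funM.
    exact: measurableT_comp mF measurable_snd.
  exact: measurableT_comp mg measurable_fst.
have h0 p : (0 <= (h p)%:E)%E by rewrite lee_fin mulr_ge0.
transitivity (\int[m']_p (h p)%:E)%E.
  rewrite (@ge0_integral_mscale _ _ _ m setT measurableT (NngNum s0))//= sE.
  congr (_ * _)%E; rewrite [RHS](ge0_integral_image _ measurable_polar_map)//.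
  apply/esym/ge0_integral_mrestr => //.
  exact: measurableT_comp mh measurable_polar_map.
transitivity (\int[(@radial_measure R n \x sigma)%E]_p (h p)%:E)%E.
  by apply: eq_measure_integral => X mX _; apply/esym; exact: mE.
rewrite fubini_tonelli1//= /fubini_F/=.
under eq_integral => r _.
  under eq_integral => y _ do rewrite /h /= mulrC EFinM.
  rewrite ge0_integralZl//.
  - over.
  - exact/measurable_EFinP.
  - by move=> y _; rewrite lee_fin.
  - by rewrite lee_fin.
rewrite /= ge0_integralZr//.
- exact/measurable_EFinP.
- by move=> r _; rewrite lee_fin.
- by apply: integral_ge0 => y _; rewrite lee_fin.
Qed.

End polar_integration.

Section homogeneous_integrals.
Context (R : realType) (n : nat).
Hypothesis n0 : (0 < n)%N.
Local Notation T := (n.-tuple R).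
Local Notation lam := (lebesgue_tuple R n).
Local Notation sigma := (@surface_measure R n).
Local Notation pos := (@punctured_space R n).
Local Notation S := (@unit_sphere R n).

Let setT_pos : [set: T] = pos `|` [set x | normv x = 0].
Proof.
apply/seteqP; split=> // x _.
by have := normv_ge0 x; rewrite le_eqVlt => /predU1P[x0|x0]; [right; exact/esym|left].
Qed.

Let mpos := @measurable_punctured_space R n.

Let morigin : measurable [set x : T | normv x = 0].
Proof.
rewrite -[X in measurable X]setTI.
exact: (@measurable_normv R n measurableT _ (measurable_set1 _)).
Qed.

(** Otherwise the Gaussian weight would have integral zero. *)
Lemma lebesgue_punctured_neq0 : lam pos != 0%E.
Proof.
apply/negP => /eqP pos0.
have lamT : lam setT = 0%E.
  rewrite setT_pos null_set_setU//; exact: lebesgue_origin_eq0.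
have [iF FE] := @integral_prod_coord R n (fun _ t => t ^+ 0 * gauss_fun t)
  (fun=> @integrable_gaussX R 0).
have := FE; rewrite /Rintegral null_set_integral//; last exact: measurable_int iF.
rewrite prodr_const card_ord => /esym/eqP; rewrite expf_eq0 n0/=.
by apply/negP; exact: (gauss_moment0_neq0 R).
Qed.

(** If the sphere had measure zero, so would all balls, by dilation, and hence
    the whole space. *)
Lemma surface_measure_gt0 : 0 < fine (sigma setT).
Proof.
rewrite fine_gt0// -ge0_fin_numE// fin_num_measure// andbT lt0e measure_ge0 andbT.
apply/negP => /eqP s0.
have c0 : lam (unit_cone setT) = 0%E.
  have /eqP := s0; rewrite surface_measureE mule_eq0 eqe pnatr_eq0 eqn0Ngt n0 /=.
  by move/eqP.
suff : lam pos = 0%E by exact/eqP/lebesgue_punctured_neq0.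
apply/negligibleP; first exact: mpos.
have -> : pos = \bigcup_(k : nat) (@radius R n @^-1` `]-oo, (k%:R : R)] `&` punctured_cone setT).
  apply/seteqP; split=> [x x0|x [k _ [_ []]]//].
  have [k _ xk] : (\bigcup_(k : nat) `]-oo, (k%:R : R)]%classic) (normv x).
    by rewrite closed_rays_cover.
  by exists k => //; split => //; split.
apply: negligible_bigcup => k; apply/negligibleP.
  apply: measurableI; last exact: measurable_punctured_cone.
  by rewrite -[X in measurable X]setTI; exact: measurable_radius.
by rewrite [LHS]lebesgue_cone_ray// [X in (_ * X)%E]c0 mule0.
Qed.

(** The absolute value makes the weight nonnegative on the whole line; on norms
    it has no effect. *)
Definition radial_weight d (r : R) : R := `|r| ^+ d * gauss_fun r.

(** Up to normalisation the integral of r^d exp(-r^2) r^(n-1) over r > 0, the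
    factor between Gaussian and spherical integrals in degree [d]. *)
Definition radial_constant d : \bar R :=
  (\int[@radial_measure R n]_r (radial_weight d r)%:E)%E.

Lemma radial_weight_ge0 d r : 0 <= radial_weight d r.
Proof. by rewrite mulr_ge0 ?exprn_ge0 ?gauss_fun_ge0. Qed.

Lemma measurable_radial_weight d : measurable_fun setT (radial_weight d).
Proof.
apply: measurable_funM; last exact: measurable_gauss_fun.
by apply: measurable_funX; exact: normr_measurable.
Qed.

(** The case of a constant spherical factor in [ge0_integral_polar]. *)
Lemma radial_constantE d :
  radial_constant d = (\int[lam]_(x in pos) (radial_weight d (normv x))%:E)%E.
Proof.
have sK : (fine (sigma setT))%:E = sigma setT by rewrite fineK// fin_num_measure.
have := @ge0_integral_polar R n (radial_weight d) (cst 1)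
  (measurable_radial_weight d) (measurable_cst _) (radial_weight_ge0 d) (fun=> ler01).
rewrite [X in _ = (_ * X)%E -> _](_ : _ = sigma setT); last first.
  exact: etrans (integral_cst _ measurableT 1) (mul1e _).
rewrite [X in _ = X -> _]muleC -sK => /(congr1 (mule (fine (sigma setT))^-1%:E)).
rewrite !muleA -!EFinM mulVf ?gt_eqF ?surface_measure_gt0// !mul1e.
rewrite -/(radial_constant d) => <-.
by apply: eq_integral => x _; rewrite /= mul1r.
Qed.

Lemma radial_constant_fin d : radial_constant d \is a fin_num.
Proof.
rewrite ge0_fin_numE; last by apply: integral_ge0 => r _; rewrite lee_fin radial_weight_ge0.
rewrite radial_constantE.
have /integrableP[mh hoo] := @integrableZl _ _ _ lam setT measurableT
  (gauss_bound R d) _ (integrable_half_gauss_normv R n).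
apply: le_lt_trans hoo; apply: (@le_trans _ _
  (\int[lam]_(x in pos) `|(gauss_bound R d)%:E * (half_gauss (normv x))%:E|)%E).
  apply: ge0_le_integral => //.
  - by move=> x _; rewrite lee_fin radial_weight_ge0.
  - apply/measurable_EFinP/measurable_funTS.
    exact: measurableT_comp (measurable_radial_weight d) (@measurable_normv R n).
  - by apply: measurable_funTS; exact: measurableT_comp.
  - move=> x _; rewrite -EFinM lee_fin (le_trans _ (ler_norm _))//.
    have := gauss_dominated d (normv x); rewrite normrM normrX.
    by rewrite (ger0_norm (gauss_fun_ge0 _)).
apply: ge0_subset_integral => //.
exact: measurableT_comp.
Qed.

Lemma radial_constant_gt0 d : 0 < fine (radial_constant d).
Proof.
have K0 : (0 <= radial_constant d)%E.
  by apply: integral_ge0 => r _; rewrite lee_fin radial_weight_ge0.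
rewrite fine_gt0// -ge0_fin_numE// radial_constant_fin andbT lt0e K0 andbT.
apply/negP => /eqP; rewrite radial_constantE => int0.
have mw : measurable_fun pos (fun x => (radial_weight d (normv x))%:E).
  apply/measurable_EFinP/measurable_funTS.
  exact: measurableT_comp (measurable_radial_weight d) (@measurable_normv R n).
have /(ae_eq_integral_abs lam mpos mw) : (\int[lam]_(x in pos)
    `|(radial_weight d (normv x))%:E| = 0)%E.
  rewrite -[RHS]int0; apply: eq_integral => x _.
  by rewrite gee0_abs// lee_fin radial_weight_ge0.
move=> [N [mN N0 subN]].
have /eqP := lebesgue_punctured_neq0; apply; apply/eqP.
rewrite -measure_le0 -N0 le_measure ?inE// => x x0; apply: subN => /= /(_ x0)/eqP.
rewrite eqe mulf_eq0 expf_eq0 normr_eq0 (gt_eqF x0) andbF/=.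
by rewrite gt_eqF// expR_gt0.
Qed.

(** The value of [G] at x is |x|^d times its value at x / |x|, so the integrand
    is a radial factor times a spherical one. *)
Lemma ge0_integral_homogeneous d (G : T -> R) :
  measurable_fun setT G -> (forall x, 0 <= G x) ->
  (forall c x, 0 < c -> G (scalev c x) = c ^+ d * G x) ->
  (sigma setT * \int[lam]_x (G x * gauss_fun (normv x))%:E =
   radial_constant d * \int[sigma]_(y in S) (G y)%:E)%E.
Proof.
move=> mG G0 Gd.
have mS := @measurable_unit_sphere R n.
have mGg : measurable_fun setT (fun x : T => (G x * gauss_fun (normv x))%:E).
  apply/measurable_EFinP/measurable_funM => //.
  exact: measurableT_comp (@measurable_gauss_fun R) (@measurable_normv R n).
rewrite (@ge0_negligible_integral _ _ _ lam setT [set x | normv x = 0])//; last 2 first.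
- by move=> x _; rewrite lee_fin mulr_ge0// gauss_fun_ge0.
- exact: lebesgue_origin_eq0.
have -> : setT `\` [set x : T | normv x = 0] = pos.
  rewrite setT_pos setDUl setDv setU0; apply/seteqP; split=> x; first by case.
  by move=> x0; split => //= x00; move: x0; rewrite /punctured_space/= x00 ltxx.
have := @ge0_integral_polar R n (radial_weight d) G (measurable_radial_weight d) mG
  (radial_weight_ge0 d) G0.
rewrite -/(radial_constant d) => polar.
transitivity (sigma setT * \int[lam]_(x in pos)
    (G (radial_proj x) * radial_weight d (normv x))%:E)%E.
  congr (_ * _)%E; apply: eq_integral => x /set_mem x0; congr EFin.
  rewrite -[in LHS](scalev_radial_proj x0) Gd// normv_scale ?normv_ge0//.
  rewrite /radial_weight ger0_norm ?normv_ge0//.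
  have -> : normv (radial_proj x) = 1 by exact: radial_proj_sphere.
  by rewrite mulr1; ring.
rewrite polar; congr (_ * _)%E.
rewrite (@ge0_negligible_integral _ _ _ sigma setT (~` S))//.
- by rewrite setTD setCK.
- exact: measurableC.
- exact/measurable_EFinP.
- by move=> x _; rewrite lee_fin.
- rewrite [LHS]surface_measureE (_ : unit_cone _ = set0) ?measure0 ?mule0//.
  apply/seteqP; split=> // x [/= xS /andP[x0 _]]; apply: xS.
  exact: radial_proj_sphere.
Qed.

(** The positive and negative parts of [G] are homogeneous of the same degree,
    and [ge0_integral_homogeneous] also shows that they are integrable against
    the Gaussian weight. *)
Lemma integral_homogeneous d (G : T -> R) :
  bounded_measurable S G ->
  (forall c x, 0 < c -> G (scalev c x) = c ^+ d * G x) ->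
  fine (sigma setT) * \int[lam]_x (G x * gauss_fun (normv x)) =
  fine (radial_constant d) * \int[sigma]_(y in S) G y.
Proof.
move=> bG Gd; have mS := @measurable_unit_sphere R n.
have [mG _] := bG.
have sK : (fine (sigma setT))%:E = sigma setT by rewrite fineK// fin_num_measure.
have s0 := surface_measure_gt0.
have part (H : T -> R) : bounded_measurable S H -> (forall x, 0 <= H x) ->
    (forall c x, 0 < c -> H (scalev c x) = c ^+ d * H x) ->
    lam.-integrable setT (EFin \o (fun x => H x * gauss_fun (normv x))) /\
    fine (sigma setT) * \int[lam]_x (H x * gauss_fun (normv x)) =
    fine (radial_constant d) * \int[sigma]_(y in S) H y.
  move=> bH H0 Hd; have [mH _] := bH.
  have iH := bounded_measurable_integrable mS sigma bH.
  have E : (\int[lam]_x (H x * gauss_fun (normv x))%:E =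
    ((fine (sigma setT))^-1 *
      (fine (radial_constant d) * \int[sigma]_(y in S) H y)%R)%:E)%E.
    have := ge0_integral_homogeneous mH H0 Hd.
    rewrite -sK -(fineK (radial_constant_fin d)).
    rewrite -(fineK (integrable_fin_num mS iH)) !EFinM => <-.
    by rewrite muleA -EFinM mulVf ?gt_eqF// mul1e.
  split; last by rewrite /Rintegral E /= mulrA mulfV ?gt_eqF// mul1r.
  apply/integrableP; split.
    apply/measurable_EFinP; apply: measurable_funM => //.
    exact: measurableT_comp (@measurable_gauss_fun R) (@measurable_normv R n).
  under eq_integral => x _ do
    rewrite /= ger0_norm ?mulr_ge0 ?gauss_fun_ge0//.
  by rewrite E ltry.
have bneg (H : T -> R) : bounded_measurable S H -> bounded_measurable S H^\+.
  move=> [mH [M HM]]; split; first exact: measurable_funrpos.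
  exists M => x Sx; rewrite ger0_norm ?funrpos_ge0// /funrpos.
  by rewrite ge_max (le_trans (ler_norm _) (HM x Sx)) (le_trans _ (HM x Sx)).
have hneg (H : T -> R) : (forall c x, 0 < c -> H (scalev c x) = c ^+ d * H x) ->
    forall c x, 0 < c -> H^\+ (scalev c x) = c ^+ d * H^\+ x.
  move=> Hd c x c0; rewrite /funrpos Hd// maxr_pMr ?mulr0//.
  by rewrite exprn_ge0// ltW.
have bN : bounded_measurable S (\- G).
  case: bG => _ [M GM]; split; first exact: measurableT_comp.
  by exists M => x Sx; rewrite normrN GM.
have [ip Ep] := part _ (bneg _ bG) (funrpos_ge0 G) (hneg _ Gd).
have [|im Em] := part _ (bneg _ bN) (funrpos_ge0 _) (hneg _ _).
  by move=> c x c0; rewrite /= Gd// mulrN.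
have GE x : G x = G^\+ x - (\- G)^\+ x.
  by rewrite /funrpos; case: (leP (G x) 0) => ?; case: (leP (- G x) 0) => ?; lra.
transitivity (fine (sigma setT) * (\int[lam]_x (G^\+ x * gauss_fun (normv x)) -
    \int[lam]_x ((\- G)^\+ x * gauss_fun (normv x)))).
  rewrite -RintegralB//; congr (_ * _); apply: eq_Rintegral => x _.
  by rewrite [in LHS]GE mulrBl.
rewrite mulrBr Ep Em -mulrBr -RintegralB//.
- by congr (_ * _); apply: eq_Rintegral => x _; rewrite -GE.
- exact: bounded_measurable_integrable (bneg _ bG).
- exact: bounded_measurable_integrable (bneg _ bN).
Qed.

End homogeneous_integrals.

(** * Charges with a density *)

Section charge_density.
Context d (T : measurableType d) (R : realType).
Variables (mu : {finite_measure set T -> \bar R}) (p : T -> R).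
Hypothesis ip : mu.-integrable setT (EFin \o p).
Local Open Scope charge_scope.

Let nu : {charge set T -> \bar R} := induced_charge ip.

Lemma induced_charge_dominates : nu `<< mu.
Proof.
apply/null_content_dominatesP => A mA A0.
apply: null_set_integral => //; apply: measurable_funTS.
exact: measurable_int ip.
Qed.

Variables (D : set T) (mD : measurable D).

(** The Jordan parts of the charge are dominated by [mu], and the difference of
    their Radon-Nikodym derivatives is [p] almost everywhere. *)
Lemma charge_integral_induced (f : T -> R) : bounded_measurable D f ->
  charge_integral nu D f = \int[mu]_(x in D) (f x * p x).
Proof.
move=> bf; have [mf [M fM]] := bf.
rewrite /charge_integral.
set HD := svalP (cid (svalP (cid (Hahn_decomposition nu)))).
have jpmu : jordan_pos HD `<< mu by apply: jordan_pos_dominates; exact: induced_charge_dominates.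
have jnmu : jordan_neg HD `<< mu by apply: jordan_neg_dominates; exact: induced_charge_dominates.
pose RN (m : {finite_measure set T -> \bar R}) := 'd (charge_of_finite_measure m) '/d mu.
have iRN (m : {finite_measure set T -> \bar R}) : m `<< mu -> mu.-integrable setT (RN m).
  by move=> mmu; exact: Radon_Nikodym_integrable.
have ifRN (m : {finite_measure set T -> \bar R}) : m `<< mu ->
    mu.-integrable D (fun x => (f x)%:E * RN m x)%E.
  move=> mmu; have iD : mu.-integrable D (RN m).
    exact: integrableS measurableT mD (@subsetT _ D) (iRN m mmu).
  apply: le_integrable (integrableZl mD M iD) => //.
    apply: emeasurable_funM; last exact: measurable_int iD.
    by apply/measurable_EFinP; exact: measurable_funTS.
  move=> x Dx; rewrite !abseM lee_wpmul2r// lee_fin.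
  by rewrite (le_trans (fM x Dx))// ler_norm.
have CV (m : {finite_measure set T -> \bar R}) : m `<< mu ->
    (\int[m]_(x in D) (f x)%:E = \int[mu]_(x in D) ((f x)%:E * RN m x))%E.
  move=> mmu; rewrite /RN Radon_Nikodym_change_of_variables//.
  exact: bounded_measurable_integrable.
have pE : ae_eq mu setT (EFin \o p) (fun x => RN (jordan_pos HD) x - RN (jordan_neg HD) x)%E.
  apply: integral_ae_eq => //.
    by apply: emeasurable_funB; apply: measurable_int; exact: iRN.
  move=> A _ mA; rewrite integralB//; last 2 first.
  - exact: integrableS measurableT mA (@subsetT _ A) (iRN _ jpmu).
  - exact: integrableS measurableT mA (@subsetT _ A) (iRN _ jnmu).
  rewrite -!Radon_Nikodym_integral//.
  rewrite [LHS](_ : _ = nu A)// (jordan_decomp HD mA) /cadd/= cscaleN1.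
  by [].
rewrite /Rintegral !CV// -fineB; last 2 first.
- by apply: integrable_fin_num => //; exact: ifRN.
- by apply: integrable_fin_num => //; exact: ifRN.
rewrite -integralB//; [|exact: ifRN..].
congr fine; apply: ae_eq_integral => //.
- by apply: emeasurable_funB; apply: measurable_int; exact: ifRN.
- apply/measurable_EFinP/measurable_funTS/measurable_funM => //.
  by apply/measurable_EFinP; exact: measurable_int ip.
- apply: filterS pE => x /(_ Logic.I) /= px Dx.
  rewrite EFinM px muleBr// fin_num_adde_defl//.
  by rewrite fin_numN; apply: Radon_Nikodym_fin_num.
Qed.

End charge_density.

(** * From vanishing moments to a vanishing transform *)

Section entire_moments.
Context d (T : measurableType d) (R : realType) (nu : {charge set T -> \bar R}).
Variables (D : set T) (mD : measurable D).
Variables (s : T -> R) (bs : bounded_measurable D s).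

(** The partial sums are bounded on [D] by the exponential of a bound of [s], so
    the series can be integrated term by term. *)
Lemma charge_integral_series (a : nat -> R) (f : R -> R) :
  measurable_fun setT f ->
  (forall k, `|a k| <= k`!%:R^-1) ->
  (forall y, \sum_(0 <= k < N) a k * y ^+ k @[N --> \oo] --> f y) ->
  (forall k, charge_integral nu D (fun x => s x ^+ k) = 0) ->
  charge_integral nu D (fun x => f (s x)) = 0.
Proof.
move=> mf ak af J0; have [ms [M0 sM0]] := bs.
pose M := `|M0|.
have sM x : D x -> `|s x| <= M by move=> Dx; rewrite (le_trans (sM0 x Dx))// ler_norm.
pose F N x := \sum_(0 <= k < N) a k * s x ^+ k.
have bF k : bounded_measurable D (fun x => a k * s x ^+ k).
  apply: bounded_measurableM; first exact: bounded_measurable_cst.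
  exact: bounded_measurableX.
have H : charge_integral nu D (F N) @[N --> \oo] --> charge_integral nu D (fun x => f (s x)).
  apply: (@charge_integral_cvg _ _ _ nu D mD F (fun x => f (s x)) (expR M)).
  - by move=> N; case: (bounded_measurable_sum (index_iota 0 N) bF).
  - exact: measurableT_comp.
  - move=> N x Dx; rewrite (le_trans (ler_norm_sum _ _ _))//.
    have cvgE := is_cvg_series_exp_coeff M.
    apply: (@le_trans _ _ (series (exp_coeff M) N)); last first.
      apply: nondecreasing_cvgn_le => //; apply: nondecreasing_series => k _ _.
      by apply: exp_coeff_ge0; exact: normr_ge0.
    rewrite /series/=; apply: ler_sum => k _.
    rewrite normrM normrX /exp_coeff/= mulrC ler_pM//.
      by apply: lerXn2r; rewrite ?nnegrE ?normr_ge0 ?sM//; exact: normr_ge0.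
  - by move=> x Dx; exact: af.
rewrite -(cvg_lim _ H)// (_ : (fun N => _) = cst 0); first exact: lim_cst.
apply/funext => N; rewrite charge_integral_sum// big1// => k _.
by rewrite charge_integralZ ?J0 ?mulr0//; exact: bounded_measurableX.
Qed.

Lemma charge_integral_cos_sin :
  (forall k, charge_integral nu D (fun x => s x ^+ k) = 0) ->
  charge_integral nu D (fun x => cos (s x)) = 0 /\
  charge_integral nu D (fun x => sin (s x)) = 0.
Proof.
move=> J0; split.
  apply: (charge_integral_series (a := fun k =>
    (~~ odd k)%:R * (-1) ^+ k./2 * k`!%:R^-1)) J0.
  - by apply: continuous_measurable_fun; exact: continuous_cos.
  - move=> k; rewrite !normrM normrX normrN1 expr1n mulr1 normfV !normr_nat.
    by rewrite ler_piMl ?invr_ge0// lern1; case: odd.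
  - move=> y; have := @is_cvg_series_cos_coeff R y.
    by rewrite cosE cos_coeffE; exact: id.
apply: (charge_integral_series (a := fun k =>
  (odd k)%:R * (-1) ^+ k.-1./2 * k`!%:R^-1)) J0.
- by apply: continuous_measurable_fun; exact: continuous_sin.
- move=> k; rewrite !normrM normrX normrN1 expr1n mulr1 normfV !normr_nat.
  by rewrite ler_piMl ?invr_ge0// lern1; case: odd.
- move=> y; have := @is_cvg_series_sin_coeff R y.
  by rewrite sinE sin_coeffE; exact: id.
Qed.

Lemma charge_integral_null (f : T -> R) : bounded_measurable D f ->
  (forall A, measurable A -> nu A = 0%E) -> charge_integral nu D f = 0.
Proof.
move=> bf nu0; have [mf _] := bf.
have mfD : measurable_fun D (EFin \o f) by apply/measurable_EFinP; exact: measurable_funTS.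
rewrite /charge_integral; set HD := svalP (cid (svalP (cid (Hahn_decomposition nu)))).
have [[mP _] [mN _] _ _] := HD.
rewrite /Rintegral !null_set_integral ?subrr//.
- by rewrite [LHS]jordan_negE cjordan_negE /crestr0 mem_set// /crestr nu0 ?oppe0//; exact: measurableI mD mN.
- by rewrite [LHS]jordan_posE cjordan_posE /crestr0 mem_set// /crestr nu0//; exact: measurableI mD mP.
Qed.

End entire_moments.

(** * The charge of harmonic density on the sphere *)

Section complex_polynomials.
Context (R : realType) (n : nat).
Local Notation T := (n.-tuple R).
Local Notation lam := (lebesgue_tuple R n).
Local Notation S := (@unit_sphere R n).
Local Open Scope complex_scope.
Import -(notations) mpoly.
Import HarmonicAlgebra.
Implicit Types (Q P : mpoly n R[i]) (x : T).

Definition real_eval Q x : R[i] := meval (fun i => (tnth x i)%:C) Q.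

(** Defined by its values on monomials, so that integration by parts is
    algebra; [integral_gauss_real_eval] identifies it with an integral. *)
Definition gaussian_mean : mpoly n R[i] -> R[i] :=
  moment (fun m => \prod_(i < n) (gauss_moment R (m i))%:C).

Section real_linear_form.
(* Stands for the real or the imaginary part. *)
Variable phi : R[i] -> R.
Hypothesis phiD : {morph phi : a b / a + b >-> a + b}.
Hypothesis phiZ : forall a (r : R), phi (a * r%:C) = phi a * r.

Let phi0 : phi 0 = 0.
Proof. by have := phiZ 0 0; rewrite mul0r mulr0. Qed.

Let phi_sum I (r : seq I) (F : I -> R[i]) :
  phi (\sum_(i <- r) F i) = \sum_(i <- r) phi (F i).
Proof. exact: (big_morph phi phiD phi0). Qed.

Lemma phi_real_evalE Q x :
  phi (real_eval Q x) = \sum_(m <- msupp Q) phi (mcoeff m Q) * \prod_(i < n) tnth x i ^+ m i.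
Proof.
rewrite /real_eval mevalE phi_sum; apply: eq_bigr => m _.
by rewrite -phiZ rmorph_prod; congr (phi (_ * _)); apply: eq_bigr => i _; rewrite rmorphXn.
Qed.

Lemma bounded_measurable_real_eval Q : bounded_measurable S (fun x => phi (real_eval Q x)).
Proof.
rewrite (funext (phi_real_evalE Q)).
apply: bounded_measurable_sum => m; apply: bounded_measurableM.
  exact: bounded_measurable_cst.
exact: bounded_measurable_monomial.
Qed.

Lemma real_eval_homogeneous d Q c x : Q \is ishomog1 d mdeg ->
  phi (real_eval Q (scalev c x)) = c ^+ d * phi (real_eval Q x).
Proof.
move=> /dhomogP Qd; rewrite !phi_real_evalE mulr_sumr.
rewrite [LHS]big_seq [RHS]big_seq; apply: eq_bigr => m mQ.
rewrite mulrCA; congr (_ * _); rewrite -(Qd _ mQ) /= mdegE expr_sum -big_split /=.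
by apply: eq_bigr => i _; rewrite tnth_mktuple exprMn.
Qed.

Lemma integral_gauss_real_eval Q :
  \int[lam]_x (phi (real_eval Q x) * gauss_fun (normv x)) = phi (gaussian_mean Q).
Proof.
rewrite /gaussian_mean /moment phi_sum.
rewrite (@eq_Rintegral _ _ _ _ _ (fun x => \sum_(m <- msupp Q) phi (mcoeff m Q) *
    ((\prod_(i < n) tnth x i ^+ m i) * gauss_fun (normv x)))); last first.
  by move=> x _; rewrite phi_real_evalE mulr_suml; apply: eq_bigr => m _; rewrite mulrA.
have mono (m : multinom n) :
    lam.-integrable setT (EFin \o (fun x : T =>
      (\prod_(i < n) tnth x i ^+ m i) * gauss_fun (normv x))) /\
    \int[lam]_x ((\prod_(i < n) tnth x i ^+ m i) * gauss_fun (normv x)) =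
    \prod_(i < n) gauss_moment R (m i).
  have [H E] := @integral_prod_coord R n (fun i t => t ^+ nth 0%N m i * gauss_fun t)
    (fun i => @integrable_gaussX R _).
  have FE (x : T) : \prod_(i < n) (tnth x i ^+ nth 0%N m i * gauss_fun (tnth x i)) =
      (\prod_(i < n) tnth x i ^+ m i) * gauss_fun (normv x).
    rewrite big_split /= prod_gauss; congr (_ * _).
    by apply: eq_bigr => i _; rewrite (mnm_nth 0%N).
  split.
    by apply: eq_integrable H => // x _; rewrite /= FE.
  transitivity (\prod_(i < n) \int[lebesgue_measure]_t (t ^+ nth 0%N m i * @gauss_fun R t)).
    by rewrite -E; apply: eq_Rintegral => x _; rewrite FE.
  by apply: eq_bigr => i _; rewrite (mnm_nth 0%N).
have monoZ m c : lam.-integrable setT (EFin \o (fun x : T =>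
      c * ((\prod_(i < n) tnth x i ^+ fun_of_multinom m i) * gauss_fun (normv x)))).
  exact: (@integrableZl _ _ _ lam setT measurableT c _ (mono m).1).
(* Integrability is carried along to make the integral additive. *)
suff [] : lam.-integrable setT (EFin \o (fun x : T => \sum_(m <- msupp Q) phi (mcoeff m Q) *
      ((\prod_(i < n) tnth x i ^+ m i) * gauss_fun (normv x)))) /\
    \int[lam]_x (\sum_(m <- msupp Q) phi (mcoeff m Q) *
      ((\prod_(i < n) tnth x i ^+ m i) * gauss_fun (normv x))) =
    \sum_(m <- msupp Q) phi (mcoeff m Q * \prod_(i < n) (gauss_moment R (m i))%:C) by [].
elim: (msupp Q) => [|m s [IHi IHe]].
  have E : (fun x : T => \sum_(m <- [::]) phi (mcoeff m Q) *
      ((\prod_(i < n) tnth x i ^+ fun_of_multinom m i) * @gauss_fun R (normv x))) = cst 0.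
    by apply/funext => x; rewrite big_nil.
  rewrite E big_nil; split; first exact: integrable0.
  by rewrite Rintegral_cst// mul0r.
have E : (fun x : T => \sum_(m0 <- m :: s) phi (mcoeff m0 Q) *
      ((\prod_(i < n) tnth x i ^+ fun_of_multinom m0 i) * @gauss_fun R (normv x))) =
    (fun x => phi (mcoeff m Q) * ((\prod_(i < n) tnth x i ^+ m i) * @gauss_fun R (normv x)) +
      \sum_(m0 <- s) phi (mcoeff m0 Q) *
      ((\prod_(i < n) tnth x i ^+ m0 i) * @gauss_fun R (normv x))).
  by apply/funext => x; rewrite big_cons.
rewrite E; split; first exact: (integrableD measurableT (monoZ m (phi (mcoeff m Q))) IHi).
rewrite RintegralD// IHe big_cons RintegralZl//; last exact: (mono m).1.
rewrite (mono m).2 -phiZ rmorph_prod.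
by [].
Qed.

Lemma real_eval_linformX (xi x : T) k Q :
  phi (real_eval (linform (fun i => (tnth xi i)%:C) ^+ k * Q) x) =
  dotv xi x ^+ k * phi (real_eval Q x).
Proof.
rewrite /real_eval mevalM rmorphXn /= mulrC (_ : meval _ (linform _) = (dotv xi x)%:C).
  by rewrite -rmorphXn phiZ mulrC.
rewrite /linform raddf_sum rmorph_sum; apply: eq_bigr => i _.
by rewrite /= mevalZ mevalXU rmorphM.
Qed.

Lemma real_eval_monomialM m x Q :
  phi (real_eval (mpolyX _ m * Q) x) = (\prod_(i < n) tnth x i ^+ m i) * phi (real_eval Q x).
Proof.
rewrite /real_eval mevalM mulrC mevalX (_ : \prod_(i < n) _ = (\prod_(i < n) tnth x i ^+ m i)%:C).
  by rewrite phiZ mulrC.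
by rewrite rmorph_prod; apply: eq_bigr => i _; rewrite rmorphXn.
Qed.

(** Both factors are positive, so a spherical integral of a homogeneous
    polynomial vanishes exactly when its Gaussian mean does. *)
Lemma sphere_integral_real_eval d Q : (0 < n)%N -> Q \is ishomog1 d mdeg ->
  fine (@surface_measure R n setT) * phi (gaussian_mean Q) =
  fine (radial_constant R n d) * \int[@surface_measure R n]_(y in S) phi (real_eval Q y).
Proof.
move=> n0 Qd; rewrite -integral_gauss_real_eval.
apply: integral_homogeneous => //; first exact: bounded_measurable_real_eval.
by move=> c x _; exact: real_eval_homogeneous.
Qed.

End real_linear_form.

Lemma gauss_moment1C : (gauss_moment R 1)%:C = 0.
Proof. by rewrite gauss_moment1. Qed.

Lemma gauss_momentSC k :
  (gauss_moment R k.+2)%:C = k.+1%:R / 2 * (gauss_moment R k)%:C.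
Proof. by rewrite gauss_momentS rmorphM fmorph_div !rmorph_nat. Qed.

Lemma gaussian_mean1_neq0 : gaussian_mean 1 != 0.
Proof.
rewrite /gaussian_mean -mpolyX0 momentX; apply/prodf_neq0 => i _.
by rewrite mnm0E fmorph_eq0 gauss_moment0_neq0.
Qed.

Lemma linform_homog (c : 'I_n -> R[i]) : linform c \is ishomog1 1 mdeg.
Proof.
apply: rpred_sum => i _; apply: rpredZ; rewrite dhomogX; apply/eqP.
exact: mdeg1.
Qed.

Section harmonic_density.
Variables (l : nat) (P : mpoly n R[i]) (phi : R[i] -> R).
Hypothesis n0 : (0 < n)%N.
Hypothesis harmP : harmonic_homog l P.
Hypothesis phiD : {morph phi : a b / a + b >-> a + b}.
Hypothesis phiZ : forall a (r : R), phi (a * r%:C) = phi a * r.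

(** Cutting [P] off outside the sphere makes the density bounded, and the
    charge supported on the sphere. *)
Definition sphere_density x : R := phi (real_eval P x) * \1_S x.

Lemma integrable_sphere_density :
  (@surface_measure R n).-integrable setT (EFin \o sphere_density).
Proof.
have mS := @measurable_unit_sphere R n.
have [mP [M PM]] := bounded_measurable_real_eval phiD phiZ P.
apply: (bounded_measurable_integrable measurableT); split.
  by apply: measurable_funM => //; exact: measurable_indic.
exists `|M| => x _; rewrite /sphere_density normrM indicE.
have [/set_mem Sx|_] := boolP (x \in S); last by rewrite normr0 mulr0.
by rewrite normr1 mulr1 (le_trans (PM x Sx))// ler_norm.
Qed.

Definition sphere_charge : {charge set T -> \bar R} :=
  induced_charge integrable_sphere_density.

Lemma charge_integral_sphere f : bounded_measurable S f ->
  charge_integral sphere_charge S f =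
  \int[@surface_measure R n]_(y in S) (f y * phi (real_eval P y)).
Proof.
move=> bf; rewrite charge_integral_induced//; last exact: measurable_unit_sphere.
apply: eq_Rintegral => y /set_mem Sy.
by rewrite /sphere_density indicE mem_set// mulr1.
Qed.

Lemma sphere_charge_supported A : A `&` S = set0 -> sphere_charge A = 0%E.
Proof.
move=> AS; apply: integral0_eq => x Ax.
rewrite /= /sphere_density indicE memNset ?mulr0// => Sx.
by have : set0 x by rewrite -AS.
Qed.

(** The moments of [dotv xi] are spherical integrals of (xi . y)^k P, whose
    Gaussian counterparts vanish by [gaussian_linformX]. *)
Lemma sphere_charge_fourier (xi : T) : real_eval P xi = 0 ->
  charge_integral sphere_charge S (fun y => cos (dotv xi y)) = 0 /\
  charge_integral sphere_charge S (fun y => sin (dotv xi y)) = 0.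
Proof.
move=> Pxi; apply: charge_integral_cos_sin.
- exact: measurable_unit_sphere.
- exact: bounded_measurable_dotv.
move=> k; rewrite charge_integral_sphere; last first.
  by apply: bounded_measurableX; exact: bounded_measurable_dotv.
have homog : linform (fun i => (tnth xi i)%:C) ^+ k * P \is ishomog1 (1 * k + l) mdeg.
  by apply: dhomogM; [apply: dhomogMn; exact: linform_homog|case: harmP].
have := sphere_integral_real_eval phiD phiZ n0 homog.
rewrite /gaussian_mean (gaussian_linformX gauss_moment1C gauss_momentSC _ harmP Pxi).
have -> : phi 0 = 0 by have := phiZ 0 0; rewrite mul0r mulr0.
rewrite mulr0 => /esym/eqP; rewrite mulf_eq0 gt_eqF ?radial_constant_gt0//= => /eqP.
by under eq_Rintegral => y _ do rewrite real_eval_linformX//.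
Qed.

Lemma sphere_charge_null_moment m : mdeg m = l ->
  (forall A, measurable A -> sphere_charge A = 0%E) ->
  phi (gaussian_mean (mpolyX _ m * P)) = 0.
Proof.
move=> ml nu0.
have bm := @bounded_measurable_monomial R n (fun i => fun_of_multinom m i).
have := charge_integral_null (@measurable_unit_sphere R n) bm nu0.
rewrite charge_integral_sphere// => int0.
have homog : mpolyX _ m * P \is ishomog1 (l + l) mdeg.
  by apply: dhomogM; [rewrite dhomogX; apply/eqP|case: harmP].
have := sphere_integral_real_eval phiD phiZ n0 homog.
under eq_Rintegral => y _ do rewrite real_eval_monomialM//.
rewrite int0 mulr0 => /eqP; rewrite mulf_eq0 gt_eqF ?surface_measure_gt0//=.
by move/eqP.
Qed.

End harmonic_density.

Lemma fourier_eq0 (mu : complex_measure T R) (xi : T) :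
  charge_integral (re_measure mu) S (fun y => cos (dotv xi y)) = 0 /\
  charge_integral (re_measure mu) S (fun y => sin (dotv xi y)) = 0 ->
  charge_integral (im_measure mu) S (fun y => cos (dotv xi y)) = 0 /\
  charge_integral (im_measure mu) S (fun y => sin (dotv xi y)) = 0 ->
  fourier mu xi = 0.
Proof.
have bsin : bounded_measurable S (fun y : T => sin (dotv xi y)).
  split; last by exists 1 => x _; rewrite ler_norml sin_geN1 sin_le1.
  apply: (@measurableT_comp _ _ _ _ _ _ (@sin R)).
    by apply: continuous_measurable_fun; exact: continuous_sin.
  by case: (bounded_measurable_dotv xi).
have cE nu : charge_integral nu S (fun y => cos (dotv xi y)) = 0 ->
    charge_integral nu S (fun y => complex.Re (expi (- dotv xi y))) = 0.
  by move=> <-; apply: eq_charge_integral => y _; rewrite /= cosN.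
have sE nu : charge_integral nu S (fun y => sin (dotv xi y)) = 0 ->
    charge_integral nu S (fun y => complex.Im (expi (- dotv xi y))) = 0.
  move=> s0; rewrite -[RHS](mulr0 (-1)) -{}s0 -charge_integralZ//.
    by apply: eq_charge_integral => y _; rewrite /= sinN mulN1r.
  exact: measurable_unit_sphere.
move=> [c1 s1] [c2 s2]; rewrite /fourier /complex_integral.
by rewrite !(cE _ c1) !(cE _ c2) !(sE _ s1) !(sE _ s2) subrr addr0.
Qed.

(** The charges of densities Re P and Im P form a measure whose transform
    vanishes on [C]. Were it zero, the Gaussian mean of x^m P would vanish for
    every [m] of degree [l], against [gaussian_coef] at a monomial of [P]. *)
Theorem harmonic_zero_not_heisenberg l (P : mpoly n R[i]) (C : set T) : (0 < n)%N ->
  harmonic_homog l P -> P != 0 -> C `<=` real_zeros P -> ~ sphere_heisenberg_pair C.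
Proof.
move=> n0 harmP P0 CP HP.
have ReD : {morph @complex.Re R : a b / a + b >-> a + b} by case=> ? ? [].
have ImD : {morph @complex.Im R : a b / a + b >-> a + b} by case=> ? ? [].
have ReZ a (r : R) : complex.Re (a * r%:C) = complex.Re a * r.
  by case: a => a b /=; rewrite mulr0 subr0.
have ImZ a (r : R) : complex.Im (a * r%:C) = complex.Im a * r.
  by case: a => a b /=; rewrite mulr0 add0r.
pose nu1 := sphere_charge P ReD ReZ; pose nu2 := sphere_charge P ImD ImZ.
pose mu := ComplexMeasure nu1 nu2.
have mu0 : forall A, measurable A -> mu A = 0.
  apply: HP.
  - move=> A mA AS; rewrite /complex_measure_fun /= /nu1 /nu2.
    by rewrite !sphere_charge_supported.
  - move=> A mA A0; rewrite /complex_measure_fun /=.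
    have nullA (nu : {charge set T -> \bar R}) : nu `<< @surface_measure R n -> nu A = 0%E.
      by move/null_content_dominatesP; apply.
    by rewrite !nullA//; exact: induced_charge_dominates.
  - move=> xi /CP Pxi.
    have [c1 s1] := sphere_charge_fourier n0 harmP ReD ReZ Pxi.
    have [c2 s2] := sphere_charge_fourier n0 harmP ImD ImZ Pxi.
    exact: (@fourier_eq0 mu xi (conj c1 s1) (conj c2 s2)).
have nu0 (nu : {charge set T -> \bar R}) A : measurable A -> fine (nu A) = 0 -> nu A = 0%E.
  by move=> mA H; rewrite -[LHS]fineK ?H// fin_num_measure.
have [m mP] : exists m, mcoeff m P != 0.
  apply: contrapT => /forallNP m0; move/eqP: P0; apply.
  by apply/mpolyP => m; rewrite mcoeff0; apply/eqP/negPn/negP; exact: m0.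
have ml : mdeg m = l.
  case: harmP => /homogP H _; apply/eqP; apply: contraNT mP => /H ->.
  by [].
have Re0 : complex.Re (gaussian_mean (mpolyX _ m * P)) = 0.
  apply: (sphere_charge_null_moment (phiD := ReD) (phiZ := ReZ) n0 harmP ml) => A mA.
  by apply: nu0 => //; case: (mu0 A mA).
have Im0 : complex.Im (gaussian_mean (mpolyX _ m * P)) = 0.
  apply: (sphere_charge_null_moment (phiD := ImD) (phiZ := ImZ) n0 harmP ml) => A mA.
  by apply: nu0 => //; case: (mu0 A mA).
have E0 : gaussian_mean (mpolyX _ m * P) = 0.
  by apply/eqP; rewrite eq_complex Re0 Im0 !eqxx.
have := gaussian_coef gauss_moment1C gauss_momentSC gaussian_mean1_neq0 harmP ml mP.
by rewrite -/gaussian_mean E0 eqxx.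
Qed.

End complex_polynomials.

Theorem theorem3p1 (R : realType) (n : nat) (hn : (2 <= n)%N)
    (C : set (n.-tuple R)) (hC : is_cone C) :
  sphere_heisenberg_pair C <->
  forall (l : nat) (P : mpoly.mpoly n R[i]),
    harmonic_homog l P -> P != 0 -> ~ (C `<=` real_zeros P).
Proof.
split=> [HC l P harmP P0 CP|]; last exact: heisenberg_of_no_harmonic_zero.
exact: harmonic_zero_not_heisenberg (ltnW hn) harmP P0 CP HC.
Qed.
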